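(* With the common parameter $\zeta=\mu=q^{s-1/2}$, the finite matrices satisfy the exact identity $$F(\mu)=2a\,\widetilde H_{\mathrm{res}}(\mu).$$ Consequently, whenever $\det H_{\mathrm{res}}(\mu)\ne0$, the labelled Jacobi scattering matrix is $$S(\mu)=-I_r+\frac{\mu^{-1}-\mu}{2}C^*\widetilde H_{\mathrm{res}}(\mu)^{-1}C,$$ and its determinant is $$\det S(\mu)=(-1)^r\frac{\det H_{\mathrm{res}}(\mu^{-1})}{\det H_{\mathrm{res}}(\mu)}.$$ The classical constant-term matrix is therefore $$\mathcal S_{\mathrm{aut}}(s)=W^{-1/2}\left[-I_r+\frac{\mu^{-1}-\mu}{2}C^*\widetilde H_{\mathrm{res}}(\mu)^{-1}C\right]W^{1/2}.$$ Thus the finite resonance matrix, together with the labelled attachment operator $C$, determines all Eisenstein constant-term coefficients. Its determinant alone determines only the scattering determinant, through the displayed formula for $\det S(\mu)$. If $$m_{\mathrm{res}}(\eta)=\operatorname{ord}_{\mu=\eta}\det H_{\mathrm{res}}(\mu),$$ then its determinantal resonance multiplicities determine the scattering-determinant divisor by $$\operatorname{ord}_{\mu_0}\det S=m_{\mathrm{res}}(\mu_0^{-1})-m_{\mathrm{res}}(\mu_0).$$ All displayed identities extend meromorphically in $\mu\in\mathbb C^\times$, with the thresholds $\mu=\pm1$ interpreted by limits when they exist.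
   Context: Let $q$ be a prime power, $a=\sqrt q$, $K=\mathbb F_q(\!(t^{-1})\!)$, $\mathcal T$ the $(q+1)$-regular Bruhat–Tits tree of $\mathrm{PGL}_2(K)$, $\Gamma<\mathrm{PGL}_2(K)$ a non-uniform arithmetic lattice, $Y=\Gamma\backslash\mathcal T$ (a graph of groups all of whose ends are cusps). For a quotient vertex $v$ with lift $\widetilde v$ let $\Gamma_v=\operatorname{Stab}_\Gamma(\widetilde v)$, $\lambda(v)=|\Gamma_v|^{-1}$. The adjacency operator, self-adjoint on $L^2(Y,\lambda)$, is $(Af)(v)=\sum_e[\Gamma_v:\Gamma_e]f(t(e))$, the sum over representatives $e$ of $\Gamma_v$-orbits of oriented tree edges issuing from $\widetilde v$, $\Gamma_e=\operatorname{Stab}_{\Gamma_v}(e)$, $t(e)$ the terminal quotient vertex. $V(Y)$ is the disjoint union of a finite compact core $\mathcal L$ of $d\ge1$ vertices and $r$ labelled rays $(c,n)$, $1\le c\le r$, $n\ge1$. The $c$-th ray is attached to the core vertex $v(c)$ by the first directed cusp edge $\varepsilon_c$ from $v(c)$ to $(c,1)$; with $(c,0):=v(c)$, $(Af)(c,n)=qf(c,n-1)+f(c,n+1)$ for $n\ge1$, and $\lambda(c,n)=w_c(q+1)q^{-n}$ for $n\ge1$; $W=\operatorname{diag}(w_1,\dots,w_r)$. Finite resonance matrix (Arends–Peterson–Weich): $A_{\mathcal L}$ is the weighted adjacency matrix of the core (the compression of $A$ to functions on the core), $m_c=|\Gamma_{v(c)}|/|\Gamma_{\varepsilon_c}|$,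 $c_v=\sum_{c:v(c)=v}m_c$, $B(\mu)$ is the diagonal matrix with $B(\mu)_{vv}=c_v\,a/\mu$, and $$H_{\mathrm{res}}(\mu)=\frac1{2a}(A_{\mathcal L}+B(\mu))-\frac{\mu+\mu^{-1}}2I_d .$$ $U_C$ is the diagonal matrix with entries $\lambda(v)^{1/2}$ on the core, and $\widetilde H_{\mathrm{res}}(\mu)=U_CH_{\mathrm{res}}(\mu)U_C^{-1}$. The labelled attachment operator $C:\mathbb C^r\to\mathbb C^d$ is $Ce_c=\sqrt{m_c}\,e_{v(c)}$, where $e_c$ and $e_{v}$ are the standard coordinate vectors of $\mathbb C^r$ and $\mathbb C^d$, and $V=aC$. Jacobi data: with $Uf=\lambda^{1/2}f$, $J=UAU^{-1}$ acts on $\mathbb C^d\oplus\bigoplus_{c=1}^r\ell^2(\mathbb N)$ as $J(u,g)=(H_Cu+Vg(1),h)$, $h(1)=ag(2)+V^*u$, $h(n)=a\{g(n-1)+g(n+1)\}$ ($n\ge2$), with $H_C$ Hermitian. Put $x(\zeta)=a(\zeta+\zeta^{-1})$, $F(\zeta)=H_C-x(\zeta)I_d+\frac{\zeta^{-1}}aVV^*$. The Jacobi scattering matrix $S(\zeta)$ is defined by: for $F(\zeta)$ invertible, $\zeta\neq\pm1$ and $\alpha\in\mathbb C^r$, the unique generalized eigenfunction of $J$ at $x(\zeta)$ with tail $\zeta^n\alpha+\zeta^{-n}\beta$ has $\beta=S(\zeta)\alpha$. The classical constant-term matrix $\mathcal S_{\mathrm{aut}}(s)$ is defined by: the generalized eigenfunction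 $\mathcal E_s(b)$ of $A$ with eigenvalue $q^s+q^{1-s}$ and incoming cusp term $q^{ns}b_c$ has cusp expansion $q^{ns}b_c+q^{n(1-s)}(\mathcal S_{\mathrm{aut}}(s)b)_c$ (meromorphically continued); its entries are the Eisenstein constant-term coefficients. $\operatorname{ord}$ denotes order of vanishing of a meromorphic function (negative at poles). *)

(* Defs.v *)
From HB Require Import structures.
From mathcomp Require Import all_boot all_order all_algebra complex spectral finmap.
From mathcomp Require Import all_classical all_reals all_analysis.

Set Implicit Arguments.
Unset Strict Implicit.
Unset Printing Implicit Defensive.

Import Order.TTheory GRing.Theory Num.Theory numFieldNormedType.Exports.

Local Open Scope classical_set_scope.
Local Open Scope ring_scope.
Local Open Scope complex_scope.
Local Open Scope sesquilinear_scope.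

(* As a [numClosedFieldType], R[i] inherits the topology of its norm from
   [numFieldNormedType], which the bare type R[i] does not. *)
Definition Cplx (R : realType) : numClosedFieldType := R[i].

Definition rc (R : realType) (x : R) : Cplx R := x%:C.

(* q ^ z = exp (z ln q) *)
Definition cpow (R : realType) (q : nat) (z : Cplx R) : Cplx R :=
  let: x +i* y := z in
  let l := ln (q%:R : R) in
  (expR (x * l) * cos (y * l)) +i* (expR (x * l) * sin (y * l)).

Section Meromorphic.
Context {R : realType}.
Implicit Types (f g : Cplx R -> Cplx R) (eta : Cplx R).

Definition holomorphic_near g eta := \forall z \near eta, derivable g z 1.

(* Values of f at eta itself are irrelevant: a meromorphic function is
   represented by any total function with the right values off a discrete
   set. *)
Definition meromorphic_at f eta :=
  exists (n : nat) g, holomorphic_near g eta /\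
    \forall z \near eta^', f z = (z - eta) ^- n * g z.

Definition has_order f eta (k : int) :=
  exists g, [/\ holomorphic_near g eta, g eta != 0 &
    \forall z \near eta^', f z = (z - eta) ^ k * g z].

Definition ord f eta : int := xget 0 [set k | has_order f eta k].

(* Equality of f and g as meromorphic functions on the punctured plane. *)
Definition meromorphic_eq f g := forall eta, eta != 0 ->
  [/\ meromorphic_at f eta, meromorphic_at g eta &
      \forall z \near eta^', f z = g z].

Definition mx_meromorphic_eq m n (f g : Cplx R -> 'M[Cplx R]_(m, n)) :=
  forall i j, meromorphic_eq (fun z => f z i j) (fun z => g z i j).

End Meromorphic.

(* [lf_coef x n] is the coefficient of t^n in x; the axioms say that it
   identifies [lf_field] with the ring of formal Laurent series in t^-1. *)
Record laurentField (F : finFieldType) := LaurentField {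
  lf_field :> fieldType;
  lf_coef : lf_field -> int -> F;
  lf_t : lf_field;
  lf_coef_inj : forall x y, lf_coef x =1 lf_coef y -> x = y;
  lf_coef_bounded : forall x, exists N : int, forall n, N < n -> lf_coef x n = 0;
  lf_coef_surj : forall u : int -> F,
    (exists N : int, forall n, N < n -> u n = 0) -> exists x, lf_coef x =1 u;
  lf_coefD : forall x y n, lf_coef (x + y) n = lf_coef x n + lf_coef y n;
  lf_coefM : forall x y n,
    lf_coef (x * y) n = \sum_(i \in [set: int]) lf_coef x i * lf_coef y (n - i);
  lf_coef_t : forall n, lf_coef lf_t n = (n == 1)%:R
}.

Definition ncard (T : choiceType) (A : set T) : nat := #|` fset_set A |.

(* Elements of PGL_2(K) are classes of matrices up to scalars, and vertices of
   the tree are homothety classes of lattices in K^2. *)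
Notation pgl K := (set 'M[K]_2).
Notation vertex K := (set (set 'cV[K]_2)).

Section Tree.
Context {F : finFieldType} {K : laurentField F}.
Implicit Types (g : 'M[K]_2) (L : set 'cV[K]_2) (x y : vertex K).
Implicit Types (gam del : pgl K) (G H : set (pgl K)).

Definition integral (z : K) := forall n : int, 0 < n -> lf_coef z n = 0.

Definition lattice g : set 'cV[K]_2 :=
  [set g *m v | v in [set v : 'cV[K]_2 | forall i, integral (v i 0)]].

Definition homothety_class g : vertex K :=
  [set lattice (c *: g) | c in [set c : K | c != 0]].

Definition tree_vertices : set (vertex K) :=
  [set homothety_class g | g in [set g | g \in unitmx]].

(* The residue field being F, the strict inclusions force [L : L'] = #|F|. *)
Definition adj x y := [/\ tree_vertices x, tree_vertices y &
  exists L L', [/\ x L, y L',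
    [set (lf_t K)^-1 *: v | v in L] `<` L' & L' `<` L]].

Definition scalar_class g : pgl K :=
  [set c *: g | c in [set c : K | c != 0]].

Definition PGL2 : set (pgl K) :=
  [set scalar_class g | g in [set g | g \in unitmx]].

Definition pmul gam del : pgl K := [set a *m b | a in gam & b in del].
Definition pinv gam : pgl K := [set invmx a | a in gam].

Definition pact gam x : vertex K :=
  [set [set a *m v | v in L] | a in gam & L in x].

Definition pgl_subgroup G := [/\ G `<=` PGL2, G (scalar_class 1%:M),
  (forall gam del, G gam -> G del -> G (pmul gam del)) &
  (forall gam, G gam -> G (pinv gam))].

Definition stab G x : set (pgl K) := [set gam | G gam /\ pact gam x = x].

(* The tree being simple, an oriented edge is its pair of end points. *)
Definition edge_stab G x y : set (pgl K) :=
  [set gam | stab G x gam /\ pact gam y = y].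

Definition same_orbit G x y := exists2 gam, G gam & y = pact gam x.

(* Discreteness is finiteness of the vertex stabilizers; up to normalization,
   the covolume is the sum of 1 / |G_x| over the orbits of vertices, and G is
   uniform when there are finitely many orbits. *)
Definition inequivalent G (X : set (vertex K)) := X `<=` tree_vertices /\
  forall x y, X x -> X y -> same_orbit G x y -> x = y.

Definition tree_lattice G := [/\ pgl_subgroup G,
  (forall x, tree_vertices x -> finite_set (stab G x)) &
  exists M : rat, forall X, finite_set X -> inequivalent G X ->
    \sum_(x \in X) ((ncard (stab G x))%:R : rat)^-1 <= M].

Definition nonuniform G :=
  ~ exists2 X : set (vertex K), finite_set X &
      forall y, tree_vertices y -> exists2 x, X x & same_orbit G x y.

End Tree.

Section Arithmetic.
Context {F : finFieldType} {K : laurentField F}.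
Implicit Types (x y : K) (k O : set K) (D Lam : set 'M[K]_2) (G H : set (pgl K)).

Definition subfield k := [/\ k 1,
  (forall x y, k x -> k y -> k (x - y)) &
  (forall x y, k x -> k y -> k (x / y))].

(* Integer polynomials stand for polynomials over the prime field. *)
Definition eval_int (p : {poly int}) y : K := (map_poly intr p).[y].

(* A finite extension of F_p(y), with y transcendental. *)
Definition global_function_field k := subfield k /\
  exists y m (e : 'I_m -> K), [/\ k y, (forall i, k (e i)),
    (forall p : {poly int}, eval_int p y = 0 ->
       map_poly (intr : int -> K) p = 0) &
    forall x, k x -> exists p s : 'I_m -> {poly int},
      (forall i, eval_int (s i) y != 0) /\
      x = \sum_i eval_int (p i) y / eval_int (s i) y * e i].

Definition dense_subfield k := forall x (N : int),
  exists2 z, k z & forall n, N <= n -> lf_coef z n = lf_coef x n.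

Definition valuation_subring k O := [/\ O `<` k, O 1,
  (forall x y, O x -> O y -> O (x - y)),
  (forall x y, O x -> O y -> O (x * y)) &
  (forall x, k x -> O x \/ O x^-1)].

(* Elements of k regular at every place other than the one induced by K. *)
Definition S_integers k : set K := [set x | k x /\
  forall O, valuation_subring k O -> O <> k `&` integral -> O x].

Definition span_over (A : set K) m (e : 'I_m -> 'M[K]_2) : set 'M[K]_2 :=
  [set z | exists2 c : 'I_m -> K, (forall i, A (c i)) & z = \sum_i c i *: e i].

(* D is a k-subalgebra of M_2(K) spanned over k by a K-basis of M_2(K), i.e. a
   quaternion algebra over k with D (x)_k K = M_2(K); the k-forms of PGL_2 that
   become PGL_2 over K are the groups D^*/k^*. *)
Definition quaternion_form k D :=
  [/\ D 1%:M, (forall u v, D u -> D v -> D (u *m v)) &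
    exists2 e : 'I_4 -> 'M[K]_2, D = span_over k e &
      forall c : 'I_4 -> K, \sum_i c i *: e i = 0 -> forall i, c i = 0].

Definition is_order k D Lam :=
  [/\ Lam 1%:M, (forall u v, Lam u -> Lam v -> Lam (u *m v)) &
    exists m (e : 'I_m -> 'M[K]_2),
      Lam = span_over (S_integers k) e /\ D = span_over k e].

Definition order_units Lam : set (pgl K) :=
  [set scalar_class g | g in [set g | [/\ g \in unitmx, Lam g & Lam (invmx g)]]].

Definition finite_index_in H G := exists2 X : set (pgl K), finite_set X &
  forall gam, G gam -> exists gam0 h, [/\ X gam0, H h & gam = pmul gam0 h].

Definition commensurable G H :=
  finite_index_in (G `&` H) G /\ finite_index_in (G `&` H) H.

Definition arithmetic G := exists k D Lam,
  [/\ global_function_field k, dense_subfield k, quaternion_form k D,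
      is_order k D Lam & commensurable G (order_units Lam)].

Definition nonuniform_arithmetic_lattice G :=
  [/\ tree_lattice G, nonuniform G & arithmetic G].

End Arithmetic.

(* [inl v] is a core vertex; [inr (c, n)] is the vertex (c, n+1) of the c-th
   ray, since rays are indexed from 1. *)
Notation qvertex d r := ('I_d + 'I_r * nat)%type.

Section Adjacency.
Context {R : realType} {F : finFieldType} {K : laurentField F}.
Context (G : set (pgl K)) {d r : nat} (lift : qvertex d r -> vertex K).
Implicit Types (i j : qvertex d r) (x y : vertex K) (O : set (vertex K)).

Definition lies_over x i := same_orbit G (lift i) x.

(* The quotient vertex below x; the default i0 is never reached. *)
Definition below (i0 : qvertex d r) x : qvertex d r :=
  xget i0 [set j | lies_over x j].

(* Orbits of G_x on the oriented edges issuing from x, each edge being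
   represented by its terminal vertex. *)
Definition edge_orbits x : set (set (vertex K)) :=
  [set [set pact gam y | gam in stab G x] | y in adj x].

Definition edge_rep O : vertex K := xget set0 O.

Definition edge_index x y : R :=
  (ncard (stab G x))%:R / (ncard (edge_stab G x y))%:R.

Definition adjacency (f : qvertex d r -> Cplx R) : qvertex d r -> Cplx R :=
  fun i => \sum_(O \in edge_orbits (lift i))
    rc (edge_index (lift i) (edge_rep O)) * f (below i (edge_rep O)).

Definition lambda i : R := (ncard (stab G (lift i)))%:R^-1.

End Adjacency.

(* The vertex (c, n), with (c, 0) the core vertex to which the ray is
   attached. *)
Definition site d r (att : 'I_r -> 'I_d) (c : 'I_r) (n : nat) : qvertex d r :=
  if n is n'.+1 then inr (c, n') else inl (att c).

(* A labelled decomposition of V(G\T) into a core and cusp rays, with chosen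
   lifts to the tree. *)
Record cusped_quotient (R : realType) (F : finFieldType) (K : laurentField F)
    (G : set (pgl K)) (d r : nat) := CuspedQuotient {
  cq_lift : qvertex d r -> vertex K;
  cq_att : 'I_r -> 'I_d;
  (* terminal vertex of the lift of the first cusp edge issuing from the lift
     of the attachment vertex *)
  cq_eps : 'I_r -> vertex K;
  cq_w : 'I_r -> R;
  cq_lift_tree : forall i, tree_vertices (cq_lift i);
  cq_cover : forall x, tree_vertices x -> exists i, lies_over G cq_lift x i;
  cq_inj : forall i j, same_orbit G (cq_lift i) (cq_lift j) -> i = j;
  cq_eps_adj : forall c, adj (cq_lift (inl (cq_att c))) (cq_eps c);
  cq_eps_over : forall c, lies_over G cq_lift (cq_eps c) (inr (c, 0%N));
  (* consecutive vertices of a ray are joined by a single edge of the quotient *)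
  cq_ray_edge : forall c n x y x' y', adj x y -> adj x' y' ->
    lies_over G cq_lift x (site cq_att c n) ->
    lies_over G cq_lift y (site cq_att c n.+1) ->
    lies_over G cq_lift x' (site cq_att c n) ->
    lies_over G cq_lift y' (site cq_att c n.+1) ->
    exists2 gam, G gam & x' = pact gam x /\ y' = pact gam y;
  cq_ray_adjacency : forall (f : qvertex d r -> Cplx R) c n,
    adjacency G cq_lift f (site cq_att c n.+1) =
    #|F|%:R * f (site cq_att c n) + f (site cq_att c n.+2);
  cq_ray_lambda : forall c n, lambda G cq_lift (site cq_att c n.+1) =
    cq_w c * (#|F|%:R + 1) * #|F|%:R ^- n.+1
}.

Section Scattering.
Context {R : realType} {F : finFieldType} {K : laurentField F}.
Context {G : set (pgl K)} {d r : nat} (Y : cusped_quotient R G d r).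
Local Notation C := (Cplx R).
Local Notation q := #|F|.
Implicit Types (mu zeta s : C) (f phi : qvertex d r -> C) (alpha beta b : 'cV[C]_r).

Definition adjop f : qvertex d r -> C := adjacency G (cq_lift Y) f.
Definition lam : qvertex d r -> R := @lambda R _ _ G d r (cq_lift Y).
Definition sqrt_lam i : C := rc (Num.sqrt (lam i)).
Definition sqrt_q : C := rc (Num.sqrt (q%:R : R)).
Local Notation a := sqrt_q.

Definition cusp_mult (c : 'I_r) : R :=
  edge_index G (cq_lift Y (inl (cq_att Y c))) (cq_eps Y c).

Definition delta (v : 'I_d) : qvertex d r -> C := fun i => (i == inl v)%:R.

Definition core_adj : 'M[C]_d := \matrix_(v, w) adjop (delta w) (inl v).

Definition Bmx mu : 'M[C]_d :=
  diag_mx (\row_v (rc (\sum_(c | cq_att Y c == v) cusp_mult c) * (a / mu))).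

Definition Hres mu : 'M[C]_d :=
  (2 * a)^-1 *: (core_adj + Bmx mu) - ((mu + mu^-1) / 2)%:M.

Definition core_U : 'M[C]_d := diag_mx (\row_v sqrt_lam (inl v)).

Definition Hres_sym mu : 'M[C]_d := core_U *m Hres mu *m invmx core_U.

Definition attach : 'M[C]_(d, r) :=
  \matrix_(v, c) (rc (Num.sqrt (cusp_mult c)) * (v == cq_att Y c)%:R).

(* J = U A U^-1 acts on all functions, because generalized eigenfunctions are
   not square summable. *)
Definition jacobi phi : qvertex d r -> C :=
  fun i => sqrt_lam i * adjop (fun j => (sqrt_lam j)^-1 * phi j) i.

Definition H_C : 'M[C]_d := \matrix_(v, w) jacobi (delta w) (inl v).

Definition Vmx : 'M[C]_(d, r) := a *: attach.

Definition spectral_param zeta : C := a * (zeta + zeta^-1).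

Definition Fmx zeta : 'M[C]_d :=
  H_C - (spectral_param zeta)%:M + (zeta^-1 / a) *: (Vmx *m Vmx ^t*).

Definition jacobi_eigenfunction zeta alpha beta phi :=
  (forall i, jacobi phi i = spectral_param zeta * phi i) /\
  forall c n, phi (inr (c, n)) =
    zeta ^+ n.+1 * alpha c 0 + zeta ^- n.+1 * beta c 0.

Definition jacobi_scattering_at zeta (M : 'M[C]_r) :=
  [/\ zeta != 0, zeta != 1, zeta != -1, Fmx zeta \in unitmx &
    forall alpha,
      (exists! phi, exists beta, jacobi_eigenfunction zeta alpha beta phi) /\
      forall phi beta, jacobi_eigenfunction zeta alpha beta phi ->
        beta = M *m alpha].

(* Set to 0 at the exceptional parameters, where the matrix is not defined;
   the meromorphic and limit notions used below do not see these values. *)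
Definition Sjac zeta : 'M[C]_r := xget 0 [set M | jacobi_scattering_at zeta M].

Definition S_formula mu : 'M[C]_r :=
  - 1%:M + ((mu^-1 - mu) / 2) *: (attach ^t* *m invmx (Hres_sym mu) *m attach).

Definition detS_formula mu : C :=
  (-1) ^+ r * (\det (Hres mu^-1) / \det (Hres mu)).

Definition mu_of s : C := cpow q (s - 2^-1).

Definition eisenstein_eigenfunction s b beta f :=
  (forall i, adjop f i = (cpow q s + cpow q (1 - s)) * f i) /\
  forall c n, f (inr (c, n)) =
    cpow q (n.+1%:R * s) * b c 0 + cpow q (n.+1%:R * (1 - s)) * beta c 0.

(* When q^s = q^(1-s) the incoming and outgoing cusp terms coincide. *)
Definition constant_term_at s (M : 'M[C]_r) :=
  cpow q s != cpow q (1 - s) /\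
  forall b,
    (exists! f, exists beta, eisenstein_eigenfunction s b beta f) /\
    forall f beta, eisenstein_eigenfunction s b beta f -> beta = M *m b.

Definition Saut s : 'M[C]_r := xget 0 [set M | constant_term_at s M].

Definition sqrt_W : 'M[C]_r := diag_mx (\row_c rc (Num.sqrt (cq_w Y c))).

Definition Saut_formula mu : 'M[C]_r :=
  invmx sqrt_W *m S_formula mu *m sqrt_W.

Definition m_res eta : int := ord (fun mu => \det (Hres mu)) eta.

End Scattering.

Arguments sqrt_q R F : clear implicits.
Arguments mu_of {R} F s.

(* Main.v *)
(* A generalized eigenfunction of J with tail zeta^n alpha + zeta^-n beta is
   determined by its core values u: the first ray equation reads
   C^* u = alpha + beta, and the core equation becomes
   F(zeta) u = a (zeta^-1 - zeta) C alpha.  Hence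
   S = - 1 + a (zeta^-1 - zeta) C^* F^-1 C.  Here F = 2a H_res~ because C C^* is
   the diagonal matrix of the c_v, and J has its Jacobi form because detailed
   balance of A gives m_c lambda(v(c)) = q lambda(c, 1).  Sylvester's determinant
   identity turns det S into a quotient of determinants of H_res, and
   multiplying by lambda^(1/2) exchanges Eisenstein eigenfunctions and Jacobi
   eigenfunctions at mu = q^(s - 1/2).

   Since H_res is rational in mu with det H_res not identically zero, all
   identities continue meromorphically; for the constant terms one also needs
   that s |-> mu is continuous and locally injective.

   H_res determines A_L; detailed balance and the connectedness of the tree then
   determine lambda on the core, hence also W, up to one common factor, which
   cancels in both conjugations. *)

(* The quotient enters through actual lifts, stabilizers and edge orbits, so the weighted graph has
   to be extracted from the tree before any linear algebra can start. Orbit-stabilizer turns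
   [adjacency] into a plain sum over the finitely many neighbours of a lift, and every matrix entry
   of A becomes a natural number [nbr_count]. Detailed balance is then a double count of group
   elements. The record describes A only at ray vertices; symmetry of the support transfers this to
   the core and shows that a core vertex sees nothing of a ray beyond its first vertex.

   On the analytic side no identity theorem is invoked. A germ carries its order as an explicit
   factorization (z - eta)^k g with g holomorphic and nonzero at eta; z^d det H_res(z) is a nonzero
   polynomial, which supplies such a factorization at every nonzero eta.

   The scattering and constant-term matrices are chosen with default 0. Equality of two
   constant-term matrices at every s therefore requires that both are undefined at the same
   parameters, which holds because existence of such a matrix forces det H_res to be nonzero. *)
Require Import Defs.
From HB Require Import structures.
From mathcomp Require Import all_boot all_order all_algebra complex spectral finmap.
From mathcomp Require Import all_classical all_reals all_analysis.
From mathcomp Require Import ring.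
Set Implicit Arguments.
Unset Strict Implicit.
Unset Printing Implicit Defensive.
Import Order.TTheory GRing.Theory Num.Theory numFieldNormedType.Exports.
Local Open Scope classical_set_scope.
Local Open Scope ring_scope.

(** * Matrix identities *)

Section MatrixIdentities.
Context {K : fieldType}.

Lemma invmx_diag n (D : 'rV[K]_n) : (forall i, D 0 i != 0) ->
  diag_mx D \in unitmx /\ invmx (diag_mx D) = diag_mx (map_mx GRing.inv D).
Proof.
move=> D0; have DV : diag_mx D *m diag_mx (map_mx GRing.inv D) = 1%:M.
  apply/matrixP => i j; rewrite mul_diag_mx !mxE.
  by case: eqP => [->|_]; rewrite ?mulr0 // !mulr1n mulfV.
have [Du _] := mulmx1_unit DV; split=> //.
by rewrite -[LHS]mulmx1 -DV mulKmx.
Qed.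

Lemma diag_conjE n (D : 'rV[K]_n) (A : 'M[K]_n) i j : (forall i, D 0 i != 0) ->
  (diag_mx D *m A *m invmx (diag_mx D)) i j = D 0 i * A i j / D 0 j.
Proof.
move=> /invmx_diag[_ ->].
by rewrite mul_mx_diag mxE mul_diag_mx !mxE.
Qed.

Lemma invmxZl n (k : K) (A : 'M[K]_n) : k != 0 -> A \in unitmx ->
  invmx (k *: A) = k^-1 *: invmx A.
Proof. by move=> k0 Au; rewrite invmxZ // unitmxZ ?unitfE. Qed.

Lemma det_conj n (U A : 'M[K]_n) : U \in unitmx -> \det (U *m A *m invmx U) = \det A.
Proof.
move=> Uu; rewrite !det_mulmx mulrAC -det_mulmx mulmxV // det1 mul1r //.
Qed.

(** Multiplying the block matrix with rows (1, A) and (B, 1) by the unipotent with rows (1, -A) and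
    (0, 1), on the right or on the left, gives two block triangular matrices of equal
    determinant. *)
Lemma det_1B_mulmx m n (A : 'M[K]_(m, n)) (B : 'M[K]_(n, m)) :
  \det (1%:M - A *m B) = \det (1%:M - B *m A).
Proof.
have e1 : block_mx 1%:M A B 1%:M *m block_mx 1%:M (- A) 0 1%:M =
    block_mx 1%:M 0 B (1%:M - B *m A).
  by rewrite mulmx_block !(mulmx1, mul1mx, mulmx0, addr0) addNr mulmxN addrC.
have e2 : block_mx 1%:M (- A) 0 1%:M *m block_mx 1%:M A B 1%:M =
    block_mx (1%:M - A *m B) 0 B 1%:M.
  by rewrite mulmx_block !(mulmx1, mul1mx, mul0mx, add0r) mulNmx subrr.
move: (congr1 determinant e1) (congr1 determinant e2).
by rewrite !det_mulmx det_ublock !det_lblock !det1 !(mul1r, mulr1) => <- <-.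
Qed.

End MatrixIdentities.

(** * The tree of PGL_2(K) *)

Section LaurentSeries.
Context {F : finFieldType} {K : laurentField F}.
Local Notation integral := Defs.integral.
Implicit Types (x y : K) (n m : int).
Local Notation t := (lf_t K).

Lemma lf_coef0 n : lf_coef (0 : K) n = 0.
Proof. by apply: (addIr (lf_coef (0 : K) n)); rewrite -lf_coefD !add0r. Qed.

Lemma lf_coefN x n : lf_coef (- x) n = - lf_coef x n.
Proof. by apply: (addIr (lf_coef x n)); rewrite -lf_coefD !addNr lf_coef0. Qed.

Lemma lf_coefB x y n : lf_coef (x - y) n = lf_coef x n - lf_coef y n.
Proof. by rewrite lf_coefD lf_coefN. Qed.

Lemma lf_coefM_single x y n (k : int) :
  (forall i, i != k -> lf_coef x i * lf_coef y (n - i) = 0) ->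
  lf_coef (x * y) n = lf_coef x k * lf_coef y (n - k).
Proof.
move=> h; rewrite lf_coefM -(fsbig_widen [set k]) ?fsbig_set1 //.
by move=> i [_ /= /eqP ik]; exact: h.
Qed.

Lemma lf_coef_tM x n : lf_coef (t * x) n = lf_coef x (n - 1).
Proof.
rewrite (@lf_coefM_single _ _ _ 1) ?lf_coef_t ?mul1r // => i /negPf i1.
by rewrite lf_coef_t i1 mul0r.
Qed.

Lemma lf_t_neq0 : t != 0.
Proof.
apply/eqP => t0; have := lf_coef_t K 1; rewrite t0 lf_coef0 => /esym/eqP.
by rewrite oner_eq0.
Qed.

Lemma lf_coef1 n : lf_coef (1 : K) n = (n == 0)%:R.
Proof.
have := lf_coef_tM 1 (n + 1); rewrite mulr1 addrK => <-.
by rewrite lf_coef_t -subr_eq0 addrK.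
Qed.

Lemma lf_coef_tVM x n : lf_coef (t^-1 * x) n = lf_coef x (n + 1).
Proof. by rewrite -[in RHS](mulVKf lf_t_neq0 x) lf_coef_tM addrK. Qed.

Lemma lf_coef_tXM x n k : lf_coef (t ^ k * x) n = lf_coef x (n - k).
Proof.
elim: k n => [|k ih|k ih] n; first by rewrite expr0z mul1r subr0.
- rewrite exprSz -mulrA lf_coef_tM ih; congr (lf_coef x _).
  by rewrite intS opprD addrA.
- rewrite -exprz_inv exprSz -mulrA lf_coef_tVM exprz_inv ih.
  by congr (lf_coef x _); rewrite !opprK intS addrA.
Qed.

(** The degree of x in t. Counting down from an upper bound N turns the search for the top nonzero
    coefficient into a search for a least natural number. *)
Lemma lf_deg x : x != 0 ->
  exists2 n : int, lf_coef x n != 0 & forall m, n < m -> lf_coef x m = 0.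
Proof.
move=> x0; have [N hN] := lf_coef_bounded x.
have [n hn] : exists n, lf_coef x n != 0.
  apply/not_existsP => h; case/eqP: x0; apply: lf_coef_inj => n.
  by rewrite lf_coef0; apply/eqP/negPn/negP; exact: h.
have nN : n <= N by rewrite leNgt; apply: contraNN hn => /hN ->.
pose P k := lf_coef x (N - k%:Z) != 0.
have exP : exists k, P k.
  by exists `|N - n|%N; rewrite /P gez0_abs ?subr_ge0 // opprB addrC subrK.
have [k Pk kmin] := ex_minnP exP; exists (N - k%:Z) => // m km.
have [mN|/hN//] := leP m N; apply/eqP/negPn/negP => hm.
have e : N - (`|N - m|%N)%:Z = m by rewrite gez0_abs ?subr_ge0 // opprB addrC subrK.
have := kmin `|N - m|%N; rewrite /P e => /(_ hm); rewrite -lez_nat gez0_abs ?subr_ge0 // lerBrDr addrC.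
by rewrite -lerBrDr leNgt km.
Qed.

Lemma integral0 : integral (0 : K). Proof. by move=> n _; exact: lf_coef0. Qed.

Lemma integral1 : integral (1 : K).
Proof. by move=> n n0; rewrite lf_coef1 gt_eqF. Qed.

Lemma integral_nat (b : bool) : integral (b%:R : K).
Proof. by case: b; [exact: integral1|exact: integral0]. Qed.

Lemma integralD x y : integral x -> integral y -> integral (x + y).
Proof. by move=> ix iy n n0; rewrite lf_coefD ix // iy // addr0. Qed.

Lemma integralN x : integral x -> integral (- x).
Proof. by move=> ix n n0; rewrite lf_coefN ix // oppr0. Qed.

Lemma integralM x y : integral x -> integral y -> integral (x * y).
Proof.
move=> ix iy n n0; rewrite lf_coefM fsbig1 // => i _.
have [i0|i0] := ltP 0 i; first by rewrite ix // mul0r.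
by rewrite iy ?mulr0 // subr_gt0 (le_lt_trans i0).
Qed.

Lemma integral_sum (I : Type) (s : seq I) (P : pred I) (f : I -> K) :
  (forall i, P i -> integral (f i)) -> integral (\sum_(i <- s | P i) f i).
Proof. by apply: (big_ind (@Defs.integral F K)) => //; [exact: integral0|exact: integralD]. Qed.

Lemma integral_tV : integral t^-1.
Proof.
by move=> n n0; rewrite -[t^-1]mulr1 lf_coef_tVM lf_coef1 gt_eqF // addr_gt0.
Qed.

(** If m is the degree of x^-1, the coefficient of index m in x * x^-1 = 1 is the nonzero product of
    the two top coefficients, so m = 0. *)
Lemma integral_inv x : integral x -> lf_coef x 0 != 0 -> integral x^-1.
Proof.
move=> ix x0; have xn0 : x != 0 by apply: contraNneq x0 => ->; rewrite lf_coef0.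
have /lf_deg[m hm mtop] : x^-1 != 0 by rewrite invr_eq0.
have : lf_coef (x * x^-1) m = lf_coef x 0 * lf_coef x^-1 m.
  rewrite (@lf_coefM_single _ _ _ 0) ?subr0 // => i i0.
  have [ip|] := ltP 0 i; first by rewrite ix // mul0r.
  rewrite le_eqVlt (negPf i0) /= => ineg.
  by rewrite mtop ?mulr0 // ltrBrDr gtrDl.
rewrite divff // lf_coef1; case: (eqVneq m 0) => [m0 _|_ /esym/eqP].
  by move=> n n0; rewrite mtop // m0.
by rewrite mulf_eq0 (negPf x0) (negPf hm).
Qed.

(** The element t^-1 is a uniformizer: dividing x by t to the power of its degree leaves an integral
    element with nonzero constant coefficient. *)
Lemma lf_unit_decomp x : x != 0 -> exists (k : int) (u : K),
  [/\ x = t ^ k * u, integral u & integral u^-1].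
Proof.
move=> x0; have [k xk xtop] := lf_deg x0; exists k, (t ^ (- k) * x).
have iu : integral (t ^ (- k) * x).
  by move=> n n0; rewrite lf_coef_tXM opprK xtop // ltrDr.
split => //; first by rewrite mulrA -expfzDr ?lf_t_neq0 // subrr expr0z mul1r.
by apply: integral_inv => //; rewrite lf_coef_tXM opprK add0r.
Qed.

(** An integral element without constant coefficient lies in the maximal ideal, which t^-1
    generates. *)
Lemma integral_tM x : integral x -> lf_coef x 0 = 0 -> integral (t * x).
Proof.
move=> ix x0 n n0; rewrite lf_coef_tM.
have [->//|n1] := eqVneq (n - 1) 0.
by apply: ix; rewrite lt_neqAle eq_sym n1 subr_ge0 -gtz0_ge1.
Qed.

End LaurentSeries.

(** * Lattices, homothety classes and the action of PGL_2(K) *)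

Section TreeVertices.
Context {F : finFieldType} {K : laurentField F}.
Local Notation integral := Defs.integral.
Local Notation t := (lf_t K).
Implicit Types (a b g h : 'M[K]_2) (c : K) (x y : vertex K).

Definition mx_integral m n (A : 'M[K]_(m, n)) := forall i j, integral (A i j).

Lemma mx_integralM m n p (A : 'M[K]_(m, n)) (B : 'M[K]_(n, p)) :
  mx_integral A -> mx_integral B -> mx_integral (A *m B).
Proof.
move=> iA iB i j; rewrite mxE; apply: integral_sum => k _; exact: integralM.
Qed.

Lemma latticeP g (v : 'cV[K]_2) : g \in unitmx ->
  lattice g v <-> mx_integral (invmx g *m v).
Proof.
move=> gu; split=> [[w iw <-]|iv].
  by rewrite mulKmx // => i j; rewrite (ord1 j); exact: iw.
by exists (invmx g *m v); [move=> i; exact: iv|rewrite mulKVmx].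
Qed.

Lemma lattice_mulmx a g : lattice (a *m g) = [set a *m v | v in lattice g].
Proof.
apply/seteqP; split=> [_ [v iv <-]|_ [_ [v iv <-] <-]].
  by exists (g *m v); [exists v|rewrite mulmxA].
by exists v => //; rewrite mulmxA.
Qed.

Lemma lattice_scale c g : lattice (c *: g) = [set c *: v | v in lattice g].
Proof.
apply/seteqP; split=> [_ [v iv <-]|_ [_ [v iv <-] <-]].
  by exists (g *m v); [exists v|rewrite scalemxAl].
by exists v => //; rewrite scalemxAl.
Qed.

Lemma lattice_mulr g h : mx_integral h -> lattice (g *m h) `<=` lattice g.
Proof.
move=> ih _ [v iv <-]; exists (h *m v); last by rewrite mulmxA.
move=> i; apply: (mx_integralM ih) => {}i j; rewrite (ord1 j); exact: iv.
Qed.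

Lemma lattice_unit g h : h \in unitmx -> mx_integral h -> mx_integral (invmx h) ->
  lattice (g *m h) = lattice g.
Proof.
move=> hu ih ih'; apply/seteqP; split; first exact: lattice_mulr.
by have := @lattice_mulr (g *m h) _ ih'; rewrite mulmxK.
Qed.

Lemma latticeD g (v w : 'cV[K]_2) : lattice g v -> lattice g w -> lattice g (v + w).
Proof.
move=> [v' iv <-] [w' iw <-]; exists (v' + w'); last by rewrite mulmxDr.
by move=> i; rewrite mxE; exact: integralD.
Qed.

Lemma homothety_classZ c g : c != 0 -> homothety_class (c *: g) = homothety_class g.
Proof.
move=> c0; apply/seteqP; split=> [_ [d /= d0 <-]|_ [d /= d0 <-]].
  by exists (d * c); rewrite /= ?mulf_neq0 // scalerA.
by exists (d / c); rewrite /= ?mulf_neq0 ?invr_eq0 // scalerA divfK.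
Qed.

Lemma homothety_class_unit g h : h \in unitmx -> mx_integral h ->
  mx_integral (invmx h) -> homothety_class (g *m h) = homothety_class g.
Proof.
move=> hu ih ih'; apply/seteqP; split=> [_ [d /= d0 <-]|_ [d /= d0 <-]];
  by exists d => //; rewrite scalemxAl lattice_unit.
Qed.

Lemma pact_homothety a g :
  pact (scalar_class a) (homothety_class g) = homothety_class (a *m g).
Proof.
apply/seteqP; split=> [_ [_ [c c0 <-] [_ [d d0 <-] <-]]|_ [c /= c0 <-]].
  exists (c * d); first by rewrite /= mulf_neq0.
  by rewrite -lattice_mulmx -scalemxAl -scalemxAr scalerA.
exists a; first by exists 1; rewrite /= ?oner_eq0 // scale1r.
exists (lattice (c *: g)); first by exists c.
by rewrite -lattice_mulmx -scalemxAr.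
Qed.

Lemma pmul_scalar a b :
  pmul (scalar_class a) (scalar_class b) = scalar_class (a *m b).
Proof.
apply/seteqP; split=> [_ [_ [c /= c0 <-] [_ [d /= d0 <-] <-]]|_ [c /= c0 <-]].
  exists (c * d); first by rewrite /= mulf_neq0.
  by rewrite -scalemxAl -scalemxAr scalerA.
exists (c *: a); first by exists c.
by exists b; [exists 1; rewrite /= ?oner_eq0 // scale1r|rewrite scalemxAl].
Qed.

Lemma pinv_scalar a : a \in unitmx -> Defs.pinv (scalar_class a) = scalar_class (invmx a).
Proof.
move=> au; apply/seteqP; split=> [_ [_ [c /= c0 <-] <-]|_ [c /= c0 <-]].
  by exists c^-1; rewrite /= ?invr_eq0 // invmxZl.
exists (c^-1 *: a); first by exists c^-1; rewrite /= ?invr_eq0.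
by rewrite invmxZl ?invr_eq0 // invrK.
Qed.

Lemma lattice_scale_proper (e : K) g h : e != 0 -> lattice g `<` lattice h ->
    lattice (e *: g) `<` lattice (e *: h).
Proof.
move=> e0 [gh nhg]; rewrite !lattice_scale; split; first exact: image_subset.
apply: contra_not nhg => hg v hv.
have /hg[w gw ewv] : [set e *: v | v in lattice h] (e *: v) by exists v.
by rewrite -(scalerK e0 v) -ewv scalerK.
Qed.

(** Both lattices may be rescaled by a common factor, so the first one can be taken to be
    [lattice g] and only one scalar remains. *)
Lemma adj_homothety g h : g \in unitmx -> h \in unitmx ->
  adj (homothety_class g) (homothety_class h) <->
  exists c, [/\ c != 0, lattice (t^-1 *: g) `<` lattice (c *: h) &
    lattice (c *: h) `<` lattice g].
Proof.
move=> gu hu; split; last first.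
  move=> [c [c0 h1 h2]]; split; [by exists g|by exists h|].
  exists (lattice g), (lattice (c *: h)); split=> //.
  - by exists 1; rewrite /= ?oner_eq0 // scale1r.
  - by exists c.
  - by rewrite -lattice_scale.
move=> [_ _ [_ [_ [[c /= c0 <-] [d /= d0 <-] h1 h2]]]].
exists (c^-1 * d); split; first by rewrite mulf_neq0 ?invr_eq0.
  rewrite -lattice_scale in h1.
  have := lattice_scale_proper (e := c^-1) _ h1.
  by rewrite !scalerA -mulrA mulrCA mulVf // mulr1 invr_eq0; exact.
have := lattice_scale_proper (e := c^-1) _ h2.
by rewrite !scalerA mulVf // scale1r invr_eq0; exact.
Qed.

Lemma lattice_mulmx_proper a g h : a \in unitmx -> lattice g `<` lattice h ->
    lattice (a *m g) `<` lattice (a *m h).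
Proof.
move=> au [gh nhg]; rewrite !lattice_mulmx; split; first exact: image_subset.
apply: contra_not nhg => hg v hv.
have /hg[w gw awv] : [set a *m v | v in lattice h] (a *m v) by exists v.
by rewrite -(mulKmx au v) -awv mulKmx.
Qed.

(** The inclusions t^-1 L < L' < L give t^-1 L' < t^-1 L < L', so t^-1 L is the new representative;
    this is the origin of the scalar t^-1 c^-1. *)
Lemma adj_sym x y : adj x y -> adj y x.
Proof.
move=> xy; have [[g gu xg] [h hu yh] _] := xy; subst x y.
move: xy => /(adj_homothety gu hu)[c [c0 h1 h2]].
apply/(adj_homothety hu gu); exists (t^-1 * c^-1).
have tc0 : t^-1 * c^-1 != 0 by rewrite mulf_neq0 ?invr_eq0 ?lf_t_neq0.
split=> //.
  have := lattice_scale_proper tc0 h2; by rewrite !scalerA divfK.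
have := lattice_scale_proper (e := c^-1) _ h1.
by rewrite !scalerA mulVf // scale1r [c^-1 * _]mulrC invr_eq0; exact.
Qed.

Lemma adj_pact a x y : a \in unitmx -> adj x y ->
  adj (pact (scalar_class a) x) (pact (scalar_class a) y).
Proof.
move=> au xy; have [[g gu xg] [h hu yh] _] := xy; subst x y.
move: xy => /(adj_homothety gu hu)[c [c0 h1 h2]].
rewrite !pact_homothety; apply/adj_homothety; rewrite ?unitmx_mul ?au //.
exists c; split=> //; rewrite !scalemxAr; exact: lattice_mulmx_proper.
Qed.

End TreeVertices.

(** * Local finiteness and connectedness of the tree *)

Section TreeGeometry.
Context {F : finFieldType} {K : laurentField F}.
Local Notation integral := Defs.integral.
Local Notation t := (lf_t K).
Implicit Types (g h : 'M[K]_2) (x y : vertex K).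

Lemma homothety_class_lattice g h :
  lattice g = lattice h -> homothety_class g = homothety_class h.
Proof.
by move=> gh; apply/seteqP; split=> [_ [c c0 <-]|_ [c c0 <-]];
  exists c => //; rewrite !lattice_scale gh.
Qed.

(* A neighbour of [L] is represented by a lattice between [t^-1 L] and [L], which
   is determined by its image in [L / t^-1 L], a vector space over F. *)
Lemma finite_adj x : finite_set (adj x).
Proof.
have [[g gu xg]|nx] := pselect (tree_vertices x); last first.
  by rewrite (_ : adj x = set0) //; apply/seteqP; split=> // y [].
subst x.
pose res (L : set 'cV[K]_2) : set 'cV[F]_2 :=
  [set \col_i lf_coef ((invmx g *m v) i 0) 0 | v in L].
pose between L := [/\ lattice (t^-1 *: g) `<=` L, L `<=` lattice g &
  exists h, L = lattice h].
have res_sub L L' : between L -> between L' -> res L = res L' -> L `<=` L'.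
  move=> [_ Lg [h Lh]] [tL' L'g [h' L'h']] LL' v Lv.
  have : res L' (\col_i lf_coef ((invmx g *m v) i 0) 0) by rewrite -LL'; exists v.
  move=> [w L'w wv].
  have /tL' : lattice (t^-1 *: g) (v - w).
    apply/latticeP; first by rewrite unitmxZ // unitfE invr_eq0 lf_t_neq0.
    rewrite invmxZl ?invr_eq0 ?lf_t_neq0 // invrK -scalemxAl => i j.
    rewrite mxE (ord1 j); apply: integral_tM.
      rewrite mulmxBr !mxE; apply: integralD.
        by have /latticeP := Lg v Lv; rewrite gu => /(_ isT) /(_ i 0); rewrite mxE.
      have /latticeP := L'g w L'w; rewrite gu => /(_ isT) /(_ i 0).
      by rewrite mxE; exact: integralN.
    have wvi : lf_coef ((invmx g *m w) i 0) 0 = lf_coef ((invmx g *m v) i 0) 0.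
      by have /matrixP/(_ i 0) := wv; rewrite !mxE.
    rewrite mulmxBr.
    have -> : (invmx g *m v - invmx g *m w) i 0 =
        (invmx g *m v) i 0 - (invmx g *m w) i 0.
      by rewrite mxE; congr (_ + _); rewrite mxE.
    by rewrite lf_coefB wvi subrr.
  rewrite L'h' => vw; rewrite L'h' in L'w.
  by have := latticeD vw L'w; rewrite subrK.
have res_inj L L' : between L -> between L' -> res L = res L' -> L = L'.
  by move=> bL bL' e; apply/seteqP; split; exact: res_sub.
(* One candidate is chosen for each subset of the residue space. The default for subsets that come
   from no lattice is harmless: only surjectivity onto the neighbours matters. *)
pose nbr (S : {set 'cV[F]_2}) : vertex K := xget (homothety_class g)
  [set y | exists h, [/\ between (lattice h), res (lattice h) = [set` S] &
     y = homothety_class h]].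
apply: (@sub_finite_set _ _ (range nbr)); last exact: finite_image.
move=> y xy; have [_ [h hu yh] _] := xy; subst y.
move: xy => /(adj_homothety gu hu)[c [c0 [h1 _] [h2 _]]].
have bch : between (lattice (c *: h)) by split=> //; exists (c *: h).
exists [set v | `[< res (lattice (c *: h)) v >]]%SET => //.
rewrite /nbr; case: xgetP => [_ -> [h' [bh' rh' ->]]|].
  rewrite -(homothety_classZ h c0); apply: homothety_class_lattice.
  apply: res_inj => //; rewrite rh'; apply/seteqP.
  by split=> v /=; rewrite inE => /asboolP.
move=> /(_ (homothety_class h)) []; exists (c *: h); split=> //.
  by apply/seteqP; split=> v /=; rewrite inE => /asboolP.
by rewrite homothety_classZ.
Qed.

Definition mx22 (a b c d : K) : 'M[K]_2 :=
  \matrix_(i, j) if i == 0 then if j == 0 then a else b else if j == 0 then c else d.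

Lemma mx22E (A : 'M[K]_2) : A = mx22 (A 0 0) (A 0 1) (A 1 0) (A 1 1).
Proof.
by apply/matrixP => i j; rewrite mxE;
  case: i j => [[|[|//]] ?] [[|[|//]] ?] /=; congr (A _ _); exact/val_inj.
Qed.

Lemma mulmx22 a b c d a' b' c' d' : mx22 a b c d *m mx22 a' b' c' d' =
  mx22 (a * a' + b * c') (a * b' + b * d') (c * a' + d * c') (c * b' + d * d').
Proof.
apply/matrixP => i j; rewrite mxE big_ord_recl big_ord1 !mxE.
by case: i j => [[|[|//]] ?] [[|[|//]] ?] /=.
Qed.

Lemma mx22_1 : 1%:M = mx22 1 0 0 1.
Proof. by rewrite [LHS]mx22E !mxE. Qed.

Lemma mx22_integral a b c d : integral a -> integral b -> integral c ->
  integral d -> mx_integral (mx22 a b c d).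
Proof. by move=> *; move=> i j; rewrite mxE; do 2?case: ifP. Qed.

Lemma mx22_invertible A B : A *m B = 1%:M -> A \in unitmx /\ invmx A = B :> 'M[K]_2.
Proof.
move=> AB; have [Au _] := mulmx1_unit AB; split=> //.
by rewrite -[LHS]mulmx1 -AB mulKmx.
Qed.

Lemma mx22_diag_unit a : a != 0 -> mx22 a 0 0 1 \in unitmx.
Proof.
move=> a0; have [] // := @mx22_invertible (mx22 a 0 0 1) (mx22 a^-1 0 0 1).
by rewrite mulmx22 mx22_1 !(mul0r,mulr0,mulr1,addr0,add0r) mulfV.
Qed.

(** In the basis g, with O the integral elements, the three lattices are O + O, t^-1 O + O and t^-1
    O + t^-1 O. A basis vector witnesses that each inclusion is strict, because t is not
    integral. *)
Lemma adj_mul_diag g : g \in unitmx ->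
  adj (homothety_class g) (homothety_class (g *m mx22 t^-1 0 0 1)).
Proof.
move=> gu; have [t0 tV0] : t != 0 /\ t^-1 != 0 by rewrite invr_eq0 lf_t_neq0.
have [Du DV] : mx22 t^-1 0 0 1 \in unitmx /\ invmx (mx22 t^-1 0 0 1) = mx22 t 0 0 1.
  by by apply: mx22_invertible; rewrite mulmx22 mx22_1 !(mul0r,mulr0,mulr1,addr0,add0r) mulVf.
have nt : ~ integral t.
  by move=> /(_ 1 isT); rewrite lf_coef_t => /eqP; rewrite oner_eq0.
apply/adj_homothety; rewrite ?unitmx_mul ?gu //; exists 1; split.
- exact: oner_neq0.
- rewrite scale1r; split.
    have -> : t^-1 *: g = g *m mx22 t^-1 0 0 1 *m mx22 1 0 0 t^-1.
      rewrite -mulmxA mulmx22 !(mul0r,mulr0,mulr1,mul1r,addr0,add0r).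
      rewrite -mul_mx_scalar; congr (_ *m _).
      by rewrite -scalemx1 [LHS]mx22E !mxE /= !(mulr0,mulr1).
    apply: lattice_mulr; apply: mx22_integral; do ?exact: integral0.
      exact: integral1.
    exact: integral_tV.
  move=> /(_ (g *m mx22 t^-1 0 0 1 *m delta_mx 1 0)) [|v iv].
    by exists (delta_mx 1 0) => // i; rewrite mxE; exact: integral_nat.
  rewrite -scalemxAl -mulmxA scalemxAr => /(can_inj (mulKmx gu)) vE.
  apply: nt; have /(congr1 (fun w : 'cV[K]_2 => t * w 1 0)) := vE.
  rewrite !mxE big_ord_recl big_ord1 !mxE /= mulVKf // => {}vE.
  by have := iv 1; rewrite vE !(mulr0,mulr1,add0r).
- rewrite scale1r; split.
    apply: lattice_mulr; apply: mx22_integral; do ?exact: integral0.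
      exact: integral_tV.
    exact: integral1.
  move=> /(_ (g *m delta_mx 0 0)) [|v iv].
    by exists (delta_mx 0 0) => // i; rewrite mxE; exact: integral_nat.
  rewrite -mulmxA => /(can_inj (mulKmx gu)) vE.
  apply: nt; have /(congr1 (fun w : 'cV[K]_2 => t * w 0 0)) := vE.
  rewrite !mxE big_ord_recl big_ord1 !mxE /= mul0r addr0 mulVKf // mulr1 => {}vE.
  by have := iv 0; rewrite vE.
Qed.

(* Invariance under right multiplication by [h] is multiplicative in [h], and
   GL_2(K) is generated by GL_2(O) and diag(t^-1, 1). *)
Section Connectedness.
Context (P : vertex K -> Prop).
Context (P_adj : forall x y, adj x y -> P x -> P y).

Let invariant h := forall g, g \in unitmx ->
  P (homothety_class g) <-> P (homothety_class (g *m h)).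

Let invariantM h h' : h \in unitmx -> invariant h -> invariant h' -> invariant (h *m h').
Proof.
move=> hu ih ih' g gu; rewrite mulmxA (ih g gu); apply: ih'.
by rewrite unitmx_mul gu.
Qed.

Let invariantV h h' : h *m h' = 1%:M -> invariant h -> invariant h'.
Proof.
move=> hh' ih g gu; have [hu h'u] := mulmx1_unit hh'.
rewrite (ih (g *m h')) ?unitmx_mul ?gu // -mulmxA.
by rewrite (mulmx1C hh') mulmx1.
Qed.

Let invariant_unit h h' : h *m h' = 1%:M -> mx_integral h -> mx_integral h' ->
  invariant h.
Proof.
by move=> /mx22_invertible[hu <-] ih ih' g gu; rewrite homothety_class_unit.
Qed.

Local Ltac mx22_simp :=
  rewrite ?mulmx22 ?mx22_1 ?(mul0r,mulr0,mulr1,mul1r,addr0,add0r,mulVf,mulfV,lf_t_neq0).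

Local Ltac mx22_int := by apply: mx22_integral;
  rewrite ?oppr0 //; do ?[exact: integral0|exact: integral1|exact: integralN].

Let invariant_pow (k : int) : invariant (mx22 (t ^ k) 0 0 1).
Proof.
have tk0 (n : int) : t ^ n != 0 by rewrite expfz_neq0 ?lf_t_neq0.
have DV : invariant (mx22 t^-1 0 0 1).
  by move=> g gu; split; apply: P_adj; [|apply: adj_sym]; exact: adj_mul_diag.
have D : invariant (mx22 t 0 0 1).
  by apply: invariantV DV; mx22_simp.
elim: k => [|k ih|k ih].
- by move=> g gu; rewrite expr0z -mx22_1 mulmx1.
- have -> : mx22 (t ^ k.+1) 0 0 1 = mx22 (t ^ k) 0 0 1 *m mx22 t 0 0 1.
    by mx22_simp; rewrite exprSzr.
  by apply: invariantM => //; exact: mx22_diag_unit.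
- have -> : mx22 (t ^ (- k.+1%:Z)) 0 0 1 = mx22 (t ^ (- k%:Z)) 0 0 1 *m mx22 t^-1 0 0 1.
    by mx22_simp; rewrite -!exprz_inv exprSzr.
  by apply: invariantM => //; exact: mx22_diag_unit.
Qed.

Let mx22_swap2 : mx22 0 1 1 0 *m mx22 0 1 1 0 = 1%:M.
Proof. by mx22_simp. Qed.

Let invariant_swap : invariant (mx22 0 1 1 0).
Proof. by apply: (invariant_unit mx22_swap2); mx22_int. Qed.

(** Conjugation by the swap exchanges the two coordinates, so lower unipotents and diag(1, e) are
    reduced to upper unipotents and diag(e, 1). *)
Let invariant_swap_conj a b c d : mx22 d c b a \in unitmx ->
  invariant (mx22 d c b a) -> invariant (mx22 a b c d).
Proof.
move=> hu ih; have [su _] := mx22_invertible mx22_swap2.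
have -> : mx22 a b c d = mx22 0 1 1 0 *m (mx22 d c b a *m mx22 0 1 1 0).
  by mx22_simp.
by apply: invariantM => //; exact: invariantM.
Qed.

Let invariant_diag (x : K) : x != 0 -> invariant (mx22 x 0 0 1).
Proof.
move=> x0; have [k [u [xE iu iuV]]] := lf_unit_decomp x0.
have u0 : u != 0 by apply: contraNneq x0 => u0; rewrite xE u0 mulr0.
have -> : mx22 x 0 0 1 = mx22 (t ^ k) 0 0 1 *m mx22 u 0 0 1 by mx22_simp; rewrite xE.
apply: invariantM => //; first by apply: mx22_diag_unit; rewrite expfz_neq0 ?lf_t_neq0.
by apply: (@invariant_unit _ (mx22 u^-1 0 0 1)); [mx22_simp|mx22_int..].
Qed.

Let mx22_upper (x : K) : mx22 1 x 0 1 *m mx22 1 (- x) 0 1 = 1%:M.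
Proof. by mx22_simp; rewrite addNr. Qed.

(** Conjugation by diag(t^k, 1) multiplies the off-diagonal entry by t^k, which reduces x to its
    unit part u. *)
Let invariant_upper (x : K) : invariant (mx22 1 x 0 1).
Proof.
have int_upper u : integral u -> invariant (mx22 1 u 0 1).
  by move=> iu; apply: (invariant_unit (mx22_upper u)); mx22_int.
have [->|x0] := eqVneq x 0; first exact/int_upper/integral0.
have [k [u [xE iu iuV]]] := lf_unit_decomp x0.
have tk0 (n : int) : t ^ n != 0 by rewrite expfz_neq0 ?lf_t_neq0.
have -> : mx22 1 x 0 1 =
    mx22 (t ^ k) 0 0 1 *m (mx22 1 u 0 1 *m mx22 (t ^ (- k)) 0 0 1).
  by mx22_simp; rewrite -?expfzDr ?lf_t_neq0 // subrr expr0z xE.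
have [uu _] := mx22_invertible (mx22_upper u).
apply: invariantM; rewrite ?mx22_diag_unit //.
by apply: invariantM => //; exact: int_upper.
Qed.

Let invariant_all h : h \in unitmx -> invariant h.
Proof.
have main a b c d : a != 0 -> mx22 a b c d \in unitmx -> invariant (mx22 a b c d).
  (* LDU factorization, with e the Schur complement of the pivot a. *)
  move=> a0 hu; set e := d - c * b / a.
  have hE : mx22 a b c d =
    (mx22 1 0 (c / a) 1 *m (mx22 a 0 0 1 *m mx22 1 0 0 e)) *m mx22 1 (b / a) 0 1.
    by mx22_simp; rewrite /e; congr mx22; field.
  have lowE : mx22 1 0 (c / a) 1 *m mx22 1 0 (- (c / a)) 1 = 1%:M.
    by mx22_simp; rewrite subrr.
  have [lu _] := mx22_invertible lowE.
  have [uu _] := mx22_invertible (mx22_upper (b / a)).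
  have au := mx22_diag_unit a0.
  have eu : mx22 1 0 0 e \in unitmx.
    by move: hu; rewrite hE !unitmx_mul lu uu au /= andbT.
  have e0 : e != 0.
    apply/eqP => e0; have := mulmxV eu; rewrite [invmx _]mx22E mx22_1 mulmx22 e0.
    move=> /matrixP/(_ 1 1); rewrite !mxE /= !mul0r addr0 => /esym/eqP.
    by rewrite oner_eq0.
  rewrite hE; apply: invariantM => //; first by rewrite !unitmx_mul lu au eu.
  apply: invariantM => //.
    by apply: invariant_swap_conj => //; have [] := mx22_invertible (mx22_upper (c / a)).
  apply: invariantM => //; first exact: invariant_diag.
  by apply: invariant_swap_conj; [exact: mx22_diag_unit|exact: invariant_diag].
(* A zero pivot is repaired by swapping the rows; the entry below it is nonzero since h is
   invertible. *)
move=> hu; have [a0|a0] := eqVneq (h 0 0) 0; last first.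
  by rewrite [h]mx22E; apply: main => //; rewrite -mx22E.
have [su _] := mx22_invertible mx22_swap2.
have c0 : h 1 0 != 0.
  apply/eqP => c0; have := mulVmx hu; rewrite [h in _ *m h]mx22E [invmx _]mx22E.
  rewrite a0 c0 mx22_1 mulmx22 => /matrixP/(_ 0 0).
  by rewrite !mxE /= !mulr0 addr0 => /esym/eqP; rewrite oner_eq0.
have hE : h = mx22 0 1 1 0 *m mx22 (h 1 0) (h 1 1) (h 0 0) (h 0 1).
  by rewrite [LHS]mx22E; mx22_simp.
rewrite hE; apply: invariantM => //; apply: main => //.
by move: hu; rewrite {1}hE unitmx_mul su.
Qed.

(** Connectedness takes the form of propagation of a property along edges, so that no paths have to
    be built. *)
Lemma tree_connected x y : tree_vertices x -> tree_vertices y -> P x -> P y.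
Proof.
move=> [g gu <-] [h hu <-].
have := invariant_all (h := invmx g *m h) _ gu.
by rewrite mulKVmx // unitmx_mul unitmx_inv gu => /(_ hu)[].
Qed.

End Connectedness.
End TreeGeometry.

(** * Orbits of the lattice and the quotient graph *)

Section FiniteCounting.
Context {S T : choiceType}.
Implicit Types (A : set S) (f : S -> T).

Lemma ncard_fibers A f n : finite_set A ->
  (forall y, (f @` A) y -> ncard (A `&` f @^-1` [set y]) = n) ->
  ncard A = (ncard (f @` A) * n)%N.
Proof.
move=> fA hn; rewrite /ncard card_fset_sum1 (partition_big_imfset _ f) /=.
rewrite -fset_set_image // [in RHS]card_fset_sum1 big_distrl /=.
apply: eq_big_seq => y; rewrite in_fset_set ?inE; last exact: finite_image.
move=> /hn <-; rewrite mul1n big_fset_condE -card_fset_sum1; congr (#|` _|).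
have fI : finite_set (A `&` f @^-1` [set y]) by apply: sub_finite_set fA => ? [].
apply/fsetP => x; rewrite in_fset_set // !inE /= in_fset_set //.
apply/idP/idP => [/andP[/set_mem Ax /eqP fxy]|/set_mem[Ax /= fxy]].
  exact/mem_set.
by rewrite fxy eqxx andbT; exact/mem_set.
Qed.

Lemma ncard_image_inj A f : finite_set A -> set_inj A f -> ncard (f @` A) = ncard A.
Proof.
move=> fA fi; rewrite (@ncard_fibers A f 1) ?muln1 // => _ [x Ax <-].
rewrite (_ : _ `&` _ = [set x]) /ncard ?fset_set1 ?cardfs1 //.
apply/seteqP; split=> [y [Ay /= fyx]|_ ->//].
by apply: fi => //; rewrite inE.
Qed.

End FiniteCounting.

Section ProjectiveAction.
Context {F : finFieldType} {K : laurentField F}.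
Implicit Types (gam del : pgl K) (x y : vertex K).

Lemma PGL2_pinv gam : PGL2 gam -> PGL2 (Defs.pinv gam).
Proof.
by move=> [a au <-]; rewrite pinv_scalar //; exists (invmx a); rewrite //= unitmx_inv.
Qed.

Lemma pinvK gam : PGL2 gam -> Defs.pinv (Defs.pinv gam) = gam.
Proof. by move=> [a au <-]; rewrite !pinv_scalar ?unitmx_inv // invmxK. Qed.

Lemma pmulKV gam del : PGL2 gam -> PGL2 del ->
  pmul gam (pmul (Defs.pinv gam) del) = del.
Proof.
by move=> [a au <-] [b bu <-]; rewrite pinv_scalar // !pmul_scalar mulKVmx.
Qed.

Lemma pmulVK gam del : PGL2 gam -> PGL2 del ->
  pmul (Defs.pinv gam) (pmul gam del) = del.
Proof.
by move=> [a au <-] [b bu <-]; rewrite pinv_scalar // !pmul_scalar mulKmx.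
Qed.

Lemma pact_tree gam x : PGL2 gam -> tree_vertices x -> tree_vertices (pact gam x).
Proof.
move=> [a au <-] [g gu <-]; rewrite pact_homothety; exists (a *m g) => //.
by rewrite /= unitmx_mul au.
Qed.

Lemma pact_pmul gam del x : PGL2 gam -> PGL2 del -> tree_vertices x ->
  pact (pmul gam del) x = pact gam (pact del x).
Proof.
by move=> [a au <-] [b bu <-] [g gu <-]; rewrite pmul_scalar !pact_homothety mulmxA.
Qed.

Lemma pact1 x : tree_vertices x -> pact (scalar_class 1%:M) x = x.
Proof. by move=> [g gu <-]; rewrite pact_homothety mul1mx. Qed.

Lemma pactK gam x : PGL2 gam -> tree_vertices x ->
  pact (Defs.pinv gam) (pact gam x) = x.
Proof.
by move=> [a au <-] [g gu <-]; rewrite pinv_scalar // !pact_homothety mulKmx.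
Qed.

Lemma pact_adj gam x y : PGL2 gam -> adj x y -> adj (pact gam x) (pact gam y).
Proof. by move=> [a au <-]; exact: adj_pact. Qed.

End ProjectiveAction.

(** * Orbit-stabilizer counts for the lattice *)

Section LatticeOrbits.
Context {F : finFieldType} {K : laurentField F}.
Context {G : set (pgl K)} (hG : tree_lattice G).
Implicit Types (gam del : pgl K) (x y z : vertex K).

Lemma tree_lattice_PGL2 gam : G gam -> PGL2 gam.
Proof. by have [[h _ _ _] _ _] := hG; exact: h. Qed.

Lemma tree_lattice_pmul gam del : G gam -> G del -> G (pmul gam del).
Proof. by have [[_ _ h _] _ _] := hG; exact: h. Qed.

Lemma tree_lattice_pinv gam : G gam -> G (Defs.pinv gam).
Proof. by have [[_ _ _ h] _ _] := hG; exact: h. Qed.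

Lemma tree_lattice_1 : G (scalar_class 1%:M).
Proof. by have [[_ h _ _] _ _] := hG. Qed.

Lemma finite_stab x : tree_vertices x -> finite_set (stab G x).
Proof. by have [_ h _] := hG; exact: h. Qed.

Hint Resolve tree_lattice_PGL2 tree_lattice_pmul tree_lattice_pinv tree_lattice_1 finite_stab : core.

Lemma ncard_gt0 (T : choiceType) (A : set T) a : finite_set A -> A a -> (0 < ncard A)%N.
Proof.
by move=> fA Aa; rewrite /ncard cardfs_gt0; apply/fset0Pn; exists a;
  rewrite in_fset_set ?inE.
Qed.

Lemma ncard_stab_gt0 x : tree_vertices x -> (0 < ncard (stab G x))%N.
Proof.
move=> tx; apply: (@ncard_gt0 _ _ (scalar_class 1%:M)); first exact: finite_stab.
by split => //; exact: pact1.
Qed.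

Lemma same_orbit_refl x : tree_vertices x -> same_orbit G x x.
Proof. by move=> tx; exists (scalar_class 1%:M) => //; rewrite pact1. Qed.

Lemma same_orbit_sym x y : tree_vertices x -> same_orbit G x y -> same_orbit G y x.
Proof.
move=> tx [gam Gg ->]; exists (Defs.pinv gam); first exact: tree_lattice_pinv.
by rewrite pactK //; exact: tree_lattice_PGL2.
Qed.

Lemma same_orbit_trans x y z : tree_vertices x ->
  same_orbit G x y -> same_orbit G y z -> same_orbit G x z.
Proof.
move=> tx [gam Gg ->] [del Gd ->]; exists (pmul del gam); first exact: tree_lattice_pmul.
by rewrite pact_pmul //; exact: tree_lattice_PGL2.
Qed.

(** Counting group elements instead of vertices makes the counts taken from the two ends of an edge
    comparable, through inversion in G. *)
Definition transporter x (X : set (vertex K)) : set (pgl K) :=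
  [set gam | G gam /\ X (pact gam x)].

(** The elements carrying x to gam x form the left coset of the stabilizer of x by gam. *)
Lemma transporter_fiber x y : tree_vertices x -> same_orbit G x y ->
  finite_set (transporter x [set y]) /\ ncard (transporter x [set y]) = ncard (stab G x).
Proof.
move=> tx [gam Gg ->].
have -> : transporter x [set pact gam x] = pmul gam @` stab G x.
  apply/seteqP; split=> [del [Gd /= e]|_ [del [Gd e] <-]].
    exists (pmul (Defs.pinv gam) del); last by rewrite pmulKV //; exact: tree_lattice_PGL2.
    split; first by apply: tree_lattice_pmul => //; exact: tree_lattice_pinv.
    rewrite pact_pmul ?e ?pactK //; do ?exact: tree_lattice_PGL2.
    exact/PGL2_pinv/tree_lattice_PGL2.
  split; first exact: tree_lattice_pmul.
  by rewrite /= pact_pmul ?e //; exact: tree_lattice_PGL2.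
split; first exact/finite_image/finite_stab.
apply: ncard_image_inj; first exact: finite_stab.
move=> d d'; rewrite !inE => -[Gd _] [Gd' _] e.
by rewrite -(pmulVK (tree_lattice_PGL2 Gg) (tree_lattice_PGL2 Gd)) e pmulVK //; exact: tree_lattice_PGL2.
Qed.

Lemma transporter_card x X : tree_vertices x -> finite_set X ->
  X `<=` same_orbit G x ->
  finite_set (transporter x X) /\
  ncard (transporter x X) = (ncard X * ncard (stab G x))%N.
Proof.
move=> tx fX Xx.
have fT : finite_set (transporter x X).
  have -> : transporter x X = \bigcup_(y in X) transporter x [set y].
    apply/seteqP; split=> [gam [Gg Xg]|gam [y Xy [Gg /= e]]].
      by exists (pact gam x).
    by split=> //; rewrite e.
  by apply: bigcup_finite => // y /Xx /(transporter_fiber tx)[].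
split=> //; rewrite (@ncard_fibers _ _ _ (fun gam => pact gam x) (ncard (stab G x))) //.
  congr (ncard _ * _)%N; apply/seteqP; split=> [_ [gam [_ ? <-]]//|y Xy].
  by have [gam Gg e] := Xx y Xy; exists gam; rewrite // /transporter /= -e.
move=> _ [gam [Gg Xg] <-]; have /(transporter_fiber tx)[_ <-] := Xx _ Xg.
congr ncard; apply/seteqP; split=> [del [[Gd Xd] e]//|del [Gd /= e]].
by split=> //; split=> //; rewrite e.
Qed.

(** Orbit-stabilizer for the action of G_x on the edges at x: each fibre of the orbit map is a left
    coset of the edge stabilizer. *)
Lemma edge_index_orbit x y : adj x y ->
  ncard (stab G x) = (ncard [set pact gam y | gam in stab G x] * ncard (edge_stab G x y))%N.
Proof.
move=> [tx ty _]; apply: ncard_fibers; first exact: finite_stab.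
move=> _ [gam [Gg gx] <-].
have -> : stab G x `&` (fun del => pact del y) @^-1` [set pact gam y] =
    pmul gam @` edge_stab G x y.
  apply/seteqP; split=> [del [[Gd dx] /= e]|_ [del [[Gd dx] dy] <-]].
    have [Pg Pd] := (tree_lattice_PGL2 Gg, tree_lattice_PGL2 Gd).
    have PgV := PGL2_pinv Pg.
    exists (pmul (Defs.pinv gam) del); last by rewrite pmulKV.
    split; last by rewrite pact_pmul // e pactK.
    split; first by apply: tree_lattice_pmul => //; exact: tree_lattice_pinv.
    by rewrite pact_pmul // dx -{1}gx pactK.
  have [Pg Pd] := (tree_lattice_PGL2 Gg, tree_lattice_PGL2 Gd).
  split; last by rewrite /= pact_pmul // dy.
  by split; [exact: tree_lattice_pmul|rewrite pact_pmul // dx].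
apply: ncard_image_inj.
  by apply: sub_finite_set (finite_stab tx) => ? [].
move=> d d'; rewrite !inE => -[[Gd _] _] [[Gd' _] _] e.
by rewrite -(pmulVK (tree_lattice_PGL2 Gg) (tree_lattice_PGL2 Gd)) e pmulVK //; exact: tree_lattice_PGL2.
Qed.

End LatticeOrbits.

Section QuotientGraph.
Context {R : realType} {F : finFieldType} {K : laurentField F}.
Context {G : set (pgl K)} (hG : tree_lattice G) {d r : nat} (Y : cusped_quotient R G d r).
Implicit Types (i j : qvertex d r) (x y : vertex K) (f : qvertex d r -> Cplx R).
Local Notation lift := (cq_lift Y).
Local Notation C := (Cplx R).
Local Notation q := #|F|.

Let tree_lift i : tree_vertices (lift i). Proof. exact: cq_lift_tree. Qed.

Lemma below_lies_over i0 x : tree_vertices x -> lies_over G lift x (below G lift i0 x).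
Proof.
move=> tx; rewrite /below; case: xgetP => // nx.
by case: (cq_cover Y tx) => i /nx.
Qed.

Lemma lies_over_inj x i j : lies_over G lift x i -> lies_over G lift x j -> i = j.
Proof.
move=> xi xj; apply: (cq_inj (c0 := Y)).
apply: (same_orbit_trans hG _ xi) => //; apply: (same_orbit_sym hG) => //.
Qed.

Lemma below_eq i0 x j : tree_vertices x -> lies_over G lift x j ->
  below G lift i0 x = j.
Proof. by move=> tx xj; apply: lies_over_inj xj; exact: below_lies_over. Qed.

Lemma lies_over_same_orbit x y j : tree_vertices x -> same_orbit G x y ->
  lies_over G lift x j <-> lies_over G lift y j.
Proof.
move=> tx xy; split=> h; first exact: (same_orbit_trans hG _ h xy).
exact: (same_orbit_trans hG _ h (same_orbit_sym hG tx xy)).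
Qed.

Lemma lies_over_lift i : lies_over G lift (lift i) i.
Proof. exact: (same_orbit_refl hG). Qed.

Let orb x y := [set pact gam y | gam in stab G x].

Let finite_orb x y : tree_vertices x -> finite_set (orb x y).
Proof. by move=> tx; exact/finite_image/(finite_stab hG). Qed.

Let orb_refl x y : tree_vertices x -> tree_vertices y -> orb x y y.
Proof.
move=> tx ty; exists (scalar_class 1%:M); last exact: pact1.
by split; [exact: (tree_lattice_1 hG)|exact: pact1].
Qed.

Let orb_eq x y z : tree_vertices x -> tree_vertices y -> orb x y z -> orb x z = orb x y.
Proof.
move=> tx ty [gam [Gg gx] <-]; have Pg := tree_lattice_PGL2 hG Gg.
have PgV := PGL2_pinv Pg.
apply/seteqP; split=> [_ [del [Gd dx] <-]|_ [del [Gd dx] <-]]; have Pd := tree_lattice_PGL2 hG Gd.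
  exists (pmul del gam); last by rewrite pact_pmul.
  by split; [exact: (tree_lattice_pmul hG)|rewrite pact_pmul // gx].
exists (pmul del (Defs.pinv gam)).
  split; first by apply: (tree_lattice_pmul hG) => //; exact: (tree_lattice_pinv hG).
  by rewrite pact_pmul // -{1}gx pactK.
rewrite pact_pmul ?pactK //; exact: pact_tree.
Qed.

Let orb_adj x y z : adj x y -> orb x y z -> adj x z.
Proof.
move=> xy [gam [Gg gx] <-]; rewrite -{1}gx.
by apply: pact_adj => //; exact: (tree_lattice_PGL2 hG).
Qed.

Let orb_same_orbit x y z : orb x y z -> same_orbit G y z.
Proof. by move=> [gam [Gg _] <-]; exists gam. Qed.

(* By the orbit-stabilizer theorem the weight [G_x : G_e] is the size of the
   orbit of e, so that A sums over all neighbours of the lift. *)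
Lemma adjacencyE f i : adjacency G lift f i =
  \sum_(y <- fset_set (adj (lift i))) f (below G lift i y).
Proof.
have tx := tree_lift i; have fA := finite_adj (lift i).
rewrite /adjacency fsbig_finite; last exact: finite_image.
rewrite fset_set_image // [RHS](partition_big_imfset _ (orb (lift i))) /=.
apply: eq_big_seq => O /imfsetP[y /=]; rewrite in_fset_set // inE => xy.
rewrite -/(orb (lift i) y) => OE.
have [_ ty _] := xy.
have Oz : orb (lift i) y (edge_rep O).
  by rewrite -OE /edge_rep; apply: xgetPex; exists y; rewrite OE; exact: orb_refl.
set z := edge_rep O in Oz *.
have xz : adj (lift i) z by exact: orb_adj Oz.
have [_ tz _] := xz.
have orbz : orb (lift i) z = O by rewrite OE; exact: orb_eq.
have -> : rc (edge_index G (lift i) z) = (ncard O)%:R :> C.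
  have := edge_index_orbit hG xz; rewrite -/(orb (lift i) z) orbz /edge_index => ->.
  rewrite natrM mulfK; first by rewrite /rc rmorph_nat.
  rewrite pnatr_eq0 -lt0n; have := ncard_stab_gt0 hG tx.
  by rewrite (edge_index_orbit hG xz) muln_gt0 => /andP[].
transitivity (\sum_(w <- fset_set (adj (lift i)) | orb (lift i) w == O)
    f (below G lift i z)).
  rewrite big_const_seq iter_addr_0 -[RHS]mulr_natl; congr (_%:R * _).
  rewrite /ncard -size_filter; apply: perm_size; apply: uniq_perm.
  - exact: fset_uniq.
  - by rewrite filter_uniq // fset_uniq.
  move=> w; rewrite mem_filter !in_fset_set //; last first.
    by rewrite OE; exact: finite_orb.
  apply/idP/idP => [/set_mem Ow|/andP[/eqP <- /set_mem[_ tw _]]].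
    apply/andP; split.
      by rewrite -orbz; apply/eqP; apply: orb_eq => //; rewrite orbz.
    by apply/mem_set; rewrite OE in Ow; exact: orb_adj Ow.
  by apply/mem_set; exact: orb_refl.
rewrite big_seq_cond [RHS]big_seq_cond; apply: eq_bigr => w.
rewrite in_fset_set // => /andP[/set_mem xw /eqP ow]; congr f.
have [_ tw _] := xw.
apply: below_eq => //.
have wz : same_orbit G w z by apply: (@orb_same_orbit (lift i)); rewrite ow -orbz; exact: orb_refl.
exact/(lies_over_same_orbit _ tw wz)/below_lies_over.
Qed.

End QuotientGraph.

(** * Matrix entries of A as neighbour counts, and detailed balance *)

Section NeighbourCounts.
Context {R : realType} {F : finFieldType} {K : laurentField F}.
Context {G : set (pgl K)} (hG : tree_lattice G) {d r : nat} (Y : cusped_quotient R G d r).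
Implicit Types (i j : qvertex d r) (x y : vertex K) (f : qvertex d r -> Cplx R).
Implicit Types (v w : 'I_d) (c : 'I_r).
Local Notation lift := (cq_lift Y).
Local Notation C := (Cplx R).
Local Notation q := #|F|.
Local Notation site := (site (cq_att Y)).

(** By [adjacency_indicator] this is the (i, j) entry of A. As a natural number it can be cast to R,
    where [lam] lives, as well as to the complex numbers. *)
Definition nbr_count i j : nat := ncard [set y | adj (lift i) y /\ lies_over G lift y j].

Lemma finite_nbrs i j : finite_set [set y | adj (lift i) y /\ lies_over G lift y j].
Proof. by apply: sub_finite_set (finite_adj (lift i)) => y []. Qed.

Lemma adjacency_indicator i j :
  adjacency G lift (fun k => (k == j)%:R : C) i = (nbr_count i j)%:R.
Proof.
rewrite (adjacencyE hG) /= -natr_sum; congr _%:R.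
transitivity (\sum_(y <- fset_set (adj (lift i)) | below G lift i y == j) 1)%N.
  by rewrite [RHS]big_mkcond; apply: eq_bigr => y _; case: eqP.
rewrite sum1_count -size_filter; apply: perm_size; apply: uniq_perm.
- by rewrite filter_uniq // fset_uniq.
- exact: fset_uniq.
move=> y; rewrite mem_filter !in_fset_set; [|exact: finite_nbrs|exact: finite_adj].
apply/idP/idP => [/andP[/eqP <- /set_mem iy]|/set_mem[iy yj]].
  by apply/mem_set; split=> //; have [_ ty _] := iy; exact: below_lies_over.
apply/andP; split; last exact/mem_set.
by have [_ ty _] := iy; apply/eqP; exact: (below_eq hG).
Qed.

(* Both sides count the gam in G such that [lift i] is adjacent to
   [gam (lift j)], up to gam <-> gam^-1. *)
Lemma nbr_countC i j :
  (nbr_count i j * ncard (stab G (lift j)) = nbr_count j i * ncard (stab G (lift i)))%N.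
Proof.
have card_tr (k l : qvertex d r) : 
    finite_set (@transporter F K G (lift l) [set y | adj (lift k) y /\ lies_over G lift y l]) /\
    ncard (@transporter F K G (lift l) [set y | adj (lift k) y /\ lies_over G lift y l]) =
     (nbr_count k l * ncard (stab G (lift l)))%N.
  apply: (transporter_card hG).
  - exact: cq_lift_tree.
  - exact: finite_nbrs.
  - by move=> y [].
have [fT <-] := card_tr i j; have [fT' <-] := card_tr j i.
rewrite -(@ncard_image_inj _ _ _ Defs.pinv fT); last first.
  move=> g g' /set_mem[/(tree_lattice_PGL2 hG) Pg _] /set_mem[/(tree_lattice_PGL2 hG) Pg' _] e.
  by rewrite -(pinvK Pg) e pinvK.
congr ncard.
have inv k l g : @transporter F K G (lift l) [set y | adj (lift k) y /\ lies_over G lift y l] g ->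
    @transporter F K G (lift k) [set y | adj (lift l) y /\ lies_over G lift y k] (Defs.pinv g).
  move=> [Gg [kl _]]; have Pg := tree_lattice_PGL2 hG Gg.
  have GV := tree_lattice_pinv hG Gg; have [tk _ _] := kl.
  split=> //; split; last by exists (Defs.pinv g).
  have := pact_adj (PGL2_pinv Pg) (adj_sym kl).
  by rewrite pactK //; exact: cq_lift_tree.
apply/seteqP; split=> [_ [g gT <-]|g gT]; first exact: inv.
exists (Defs.pinv g); first exact: inv.
by apply: pinvK; case: gT => /(tree_lattice_PGL2 hG).
Qed.

Lemma ncard_stab_lift_gt0 i : (0 < ncard (stab G (lift i)))%N.
Proof. exact/(ncard_stab_gt0 hG)/cq_lift_tree. Qed.

Lemma lam_gt0 i : 0 < lam Y i.
Proof. by rewrite invr_gt0 ltr0n ncard_stab_lift_gt0. Qed.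

Lemma nbr_count_lam i j :
  (nbr_count i j)%:R * lam Y i = (nbr_count j i)%:R * lam Y j.
Proof.
have gi : (ncard (stab G (lift i)))%:R != 0 :> R.
  by rewrite pnatr_eq0 -lt0n ncard_stab_lift_gt0.
have gj : (ncard (stab G (lift j)))%:R != 0 :> R.
  by rewrite pnatr_eq0 -lt0n ncard_stab_lift_gt0.
by apply/eqP; rewrite /lam /lambda eqr_div // -!natrM nbr_countC.
Qed.

Lemma nbr_count_eq0 i j : nbr_count i j = 0%N -> nbr_count j i = 0%N.
Proof.
move=> ij; have := nbr_countC i j; rewrite ij mul0n => /esym/eqP.
by rewrite muln_eq0 -[(ncard _ == 0)%N]negbK -lt0n ncard_stab_lift_gt0 orbF => /eqP.
Qed.

Lemma nbr_count_gt0 i j y : adj (lift i) y -> lies_over G lift y j ->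
  (0 < nbr_count i j)%N.
Proof. by move=> iy yj; exact: (ncard_gt0 (a := y) (finite_nbrs i j)). Qed.

(** This is the ray equation tested on an indicator function. As [inr (c, n)] is the site of index n
    + 1, its neighbours are the sites n and n + 2. *)
Lemma nbr_count_ray c n j :
  nbr_count (inr (c, n)) j = (q * (site c n == j) + (site c n.+2 == j))%N.
Proof.
apply/eqP; rewrite -(eqr_nat C) -adjacency_indicator.
have := cq_ray_adjacency Y (fun k => (k == j)%:R) c n => /= ->.
by rewrite natrD natrM.
Qed.

(** The edge is read from its ray end, where all neighbours are known, and transferred to the core
    end by the symmetry of the support. *)
Lemma nbr_count_core_ray v c n :
  nbr_count (inl v) (inr (c, n)) != 0%N -> n = 0%N /\ cq_att Y c = v.
Proof.
move=> h; have {h} : nbr_count (inr (c, n)) (inl v) != 0%N.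
  by apply: contraNneq h => /nbr_count_eq0 ->.
rewrite nbr_count_ray addn0; case: n => [|n] /=; last by rewrite muln0.
by case: (inl _ =P inl v) => [[->]|_]; rewrite ?muln0.
Qed.

(** By [cq_ray_edge] the neighbours of the lift of v(c) above (c, 1) form a single orbit of its
    stabilizer, so the index of one edge already counts all of them. *)
Lemma cusp_multE c :
  cusp_mult Y c = (nbr_count (inl (cq_att Y c)) (inr (c, 0%N)))%:R.
Proof.
have xe := cq_eps_adj Y c; have eo := cq_eps_over Y c.
have [tx te _] := xe.
rewrite /cusp_mult /edge_index (edge_index_orbit hG xe) natrM mulfK; last first.
  rewrite pnatr_eq0 -lt0n; have := ncard_stab_gt0 hG tx.
  by rewrite (edge_index_orbit hG xe) muln_gt0 => /andP[].
congr ((ncard _)%:R); apply/seteqP; split=> [_ [gam [Gg gx] <-]|y [xy yo]].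
  split; first by rewrite -{1}gx; apply: pact_adj => //; exact: (tree_lattice_PGL2 hG).
  have eg : same_orbit G (cq_eps Y c) (pact gam (cq_eps Y c)) by exists gam.
  exact: (lies_over_same_orbit hG Y _ te eg).1 eo.
have lx := lies_over_lift hG Y (inl (cq_att Y c)).
have [gam Gg [gx gy]] := cq_ray_edge (c0 := Y) (c := c) (n := 0%N) xe xy lx eo lx yo.
by exists gam => //; split.
Qed.

Lemma cusp_mult_lam c : cusp_mult Y c * lam Y (inl (cq_att Y c)) =
  q%:R * lam Y (inr (c, 0%N)).
Proof.
by rewrite cusp_multE nbr_count_lam nbr_count_ray /= eqxx addn0 muln1.
Qed.

Lemma card_residue_gt1 : (1 < q)%N.
Proof. exact: card_finNzRing_gt1. Qed.

Lemma lam_ray c n : lam Y (inr (c, n)) = cq_w Y c * (q%:R + 1) * q%:R ^- n.+1.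
Proof. exact: (cq_ray_lambda Y c n). Qed.

Lemma q_neq0 : q%:R != 0 :> R.
Proof. by rewrite pnatr_eq0 -lt0n ltnW // card_residue_gt1. Qed.

(** Expresses w_c through m_c and lambda at v(c). The positivity of w_c and its recovery from core
    data both rest on this. *)
Lemma cusp_mult_lam_w c : cusp_mult Y c * lam Y (inl (cq_att Y c)) =
  cq_w Y c * (q%:R + 1).
Proof. by rewrite cusp_mult_lam lam_ray expr1 mulrC divfK // q_neq0. Qed.

Lemma cusp_mult_gt0 c : 0 < cusp_mult Y c.
Proof.
have := mulr_gt0 _ (lam_gt0 (inr (c, 0%N))); rewrite -(pmulr_rgt0 _ (lam_gt0 (inl (cq_att Y c)))).
rewrite [_ * cusp_mult _ _]mulrC cusp_mult_lam => /(_ q%:R); apply.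
by rewrite ltr0n ltnW // card_residue_gt1.
Qed.

Lemma cq_w_gt0 c : 0 < cq_w Y c.
Proof.
have q1 : 0 < q%:R + 1 :> R by rewrite addr_gt0 ?ltr01 // ltr0n ltnW // card_residue_gt1.
by rewrite -(pmulr_lgt0 _ q1) -cusp_mult_lam_w mulr_gt0 ?cusp_mult_gt0 ?lam_gt0.
Qed.

Lemma core_adjE v w : core_adj Y v w = (nbr_count (inl v) (inl w))%:R.
Proof. by rewrite mxE; exact: adjacency_indicator. Qed.

(** Every neighbour of the lift lies above exactly one core vertex or above the first vertex of a
    ray attached at v. Once the counts are expanded over neighbours and the sums exchanged, one
    indicator survives for each neighbour. *)
Lemma adjop_core f v : adjop Y f (inl v) =
  \sum_w core_adj Y v w * f (inl w) +
  \sum_(c | cq_att Y c == v) rc (cusp_mult Y c) * f (inr (c, 0%N)).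
Proof.
have ind i j : (nbr_count i j)%:R =
    \sum_(y <- fset_set (adj (lift i))) (below G lift i y == j)%:R :> C.
  by rewrite -adjacency_indicator (adjacencyE hG).
under eq_bigr => w _ do rewrite core_adjE ind big_distrl /=.
under [X in _ = _ + X]eq_bigr => c /eqP cv.
  rewrite cusp_multE cv /rc rmorph_nat ind big_distrl /=; over.
rewrite exchange_big [X in _ = _ + X]exchange_big -big_split /=.
rewrite /adjop (adjacencyE hG); apply: eq_big_seq => y.
rewrite in_fset_set; last exact: finite_adj.
move=> /set_mem vy.
have [_ ty _] := vy.
have := below_lies_over Y (inl v) ty; set b := below _ _ _ y => yb.
have := nbr_count_gt0 (i := inl v) vy yb.
case: b yb => [w|[c n]] yb.
  move=> _; rewrite (bigD1 w) //= eqxx mul1r big1 ?addr0 => [|w' w'w].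
    rewrite big1 ?addr0 // => c _; by rewrite mul0r.
  by rewrite (_ : inl w == inl w' = false) ?mul0r //; apply/eqP => -[]/eqP; rewrite eq_sym (negPf w'w).
rewrite lt0n => /nbr_count_core_ray[n0 cv]; subst n.
rewrite big1 ?add0r => [|w _]; last by rewrite mul0r.
rewrite (bigD1 c) /= ?cv // eqxx mul1r big1 ?addr0 // => c' /andP[_ c'c].
by rewrite (_ : inr _ == inr _ = false) ?mul0r //; apply/eqP => -[]/eqP; rewrite eq_sym (negPf c'c).
Qed.

Lemma adjop_ray f c n : adjop Y f (inr (c, n)) =
  q%:R * f (site c n) + f (inr (c, n.+1)).
Proof. exact: (cq_ray_adjacency Y f c n). Qed.

End NeighbourCounts.

(** * Holomorphic germs, orders and complex powers *)

Section HolomorphicGerms.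
Context {R : realType}.
Local Notation C := (Cplx R).
Implicit Types (f g : C -> C) (eta z : C).

(** Differentiability at a nearby point needs equality around that point as well, which is what
    [near_join] provides. *)
Lemma near_eq_holomorphic f g eta :
  (\forall z \near eta, f z = g z) -> holomorphic_near g eta ->
  holomorphic_near f eta.
Proof.
move=> fg hg.
have {}fg : \forall z \near eta, \forall y \near z, f y = g y.
  exact/near_join/fg.
apply: filterS2 fg hg => z fg dg.
apply: near_eq_derivable dg; apply: filterS fg => y ->//.
Qed.

Lemma eq_holomorphic f g eta :
  f =1 g -> holomorphic_near g eta -> holomorphic_near f eta.
Proof. by move=> /funext ->. Qed.

Lemma holomorphic_cst (c : C) eta : holomorphic_near (fun=> c) eta.
Proof. by apply: (@filterE _ (nbhs eta)) => z; exact: derivable_cst. Qed.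

Lemma holomorphic_id eta : holomorphic_near id eta.
Proof. by apply: (@filterE _ (nbhs eta)) => z; exact: derivable_id. Qed.

Lemma holomorphicD f g eta : holomorphic_near f eta -> holomorphic_near g eta ->
  holomorphic_near (fun z => f z + g z) eta.
Proof. by apply: filterS2 => z df dg; exact: (@derivableD C C C f g z 1 df dg). Qed.

Lemma holomorphicN f eta : holomorphic_near f eta ->
  holomorphic_near (fun z => - f z) eta.
Proof. by apply: filterS => z df; exact: (@derivableN C C C f z 1 df). Qed.

Lemma holomorphicM f g eta : holomorphic_near f eta -> holomorphic_near g eta ->
  holomorphic_near (fun z => f z * g z) eta.
Proof. by apply: filterS2 => z df dg; exact: (@derivableM C C f g z 1 df dg). Qed.

Lemma holomorphic_sum (I : Type) (s : seq I) (P : pred I) (F : I -> C -> C) eta :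
  (forall i, P i -> holomorphic_near (F i) eta) ->
  holomorphic_near (fun z => \sum_(i <- s | P i) F i z) eta.
Proof.
move=> hF; elim: s => [|i s ih].
  by apply: (@eq_holomorphic _ (fun=> 0)) => [z|];
    [rewrite big_nil|exact: holomorphic_cst].
case Pi: (P i); last by apply: eq_holomorphic ih => z; rewrite big_cons Pi.
apply: (eq_holomorphic _ (holomorphicD (hF i Pi) ih)) => z.
by rewrite big_cons Pi.
Qed.

Lemma holomorphic_prod (I : Type) (s : seq I) (P : pred I) (F : I -> C -> C) eta :
  (forall i, P i -> holomorphic_near (F i) eta) ->
  holomorphic_near (fun z => \prod_(i <- s | P i) F i z) eta.
Proof.
move=> hF; elim: s => [|i s ih].
  by apply: (@eq_holomorphic _ (fun=> 1)) => [z|];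
    [rewrite big_nil|exact: holomorphic_cst].
case Pi: (P i); last by apply: eq_holomorphic ih => z; rewrite big_cons Pi.
apply: (eq_holomorphic _ (holomorphicM (hF i Pi) ih)) => z.
by rewrite big_cons Pi.
Qed.

Lemma holomorphicX f n eta : holomorphic_near f eta ->
  holomorphic_near (fun z => f z ^+ n) eta.
Proof.
move=> hf; elim: n => [|n ih].
  exact: (@holomorphic_cst 1).
by apply: (eq_holomorphic _ (holomorphicM hf ih)) => z; rewrite exprS.
Qed.

Lemma holomorphic_horner (p : {poly C}) eta : holomorphic_near (horner p) eta.
Proof.
have -> : horner p = fun z => \sum_(i < size p) p`_i * z ^+ i.
  by apply/funext => z; exact: horner_coef.
apply: holomorphic_sum => i _; apply: holomorphicM; first exact: holomorphic_cst.
exact/holomorphicX/holomorphic_id.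
Qed.

Lemma holomorphic_det n (M : C -> 'M[C]_n) eta :
  (forall i j, holomorphic_near (fun z => M z i j) eta) ->
  holomorphic_near (fun z => \det (M z)) eta.
Proof.
move=> hM; apply: holomorphic_sum => s _; apply: holomorphicM.
  exact: holomorphic_cst.
by apply: holomorphic_prod => i _.
Qed.

Lemma holomorphic_continuous f eta : holomorphic_near f eta ->
  f z @[z --> eta] --> f eta.
Proof.
by move=> /nbhs_singleton /derivable1_diffP; exact: differentiable_continuous.
Qed.

Lemma holomorphic_cvg_dnbhs f eta : holomorphic_near f eta ->
  f z @[z --> eta^'] --> f eta.
Proof.
by move=> /holomorphic_continuous hf; exact: cvg_within_filter hf.
Qed.

Lemma continuous_neq0 f eta : f z @[z --> eta] --> f eta -> f eta != 0 ->
  \forall z \near eta, f z != 0.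
Proof. by move=> fc f0; exact: cvgr_neq0 fc f0. Qed.

Lemma holomorphicV f eta : holomorphic_near f eta -> f eta != 0 ->
  holomorphic_near (fun z => (f z)^-1) eta.
Proof.
move=> hf f0; have := continuous_neq0 (holomorphic_continuous hf) f0.
by move: hf; apply: filterS2 => z df fz0; exact: derivableV.
Qed.

Lemma holomorphic_inv eta : eta != 0 -> holomorphic_near (fun z => z^-1) eta.
Proof. exact/holomorphicV/holomorphic_id. Qed.

Lemma holomorphicXz f (k : int) eta : holomorphic_near f eta -> f eta != 0 ->
  holomorphic_near (fun z => f z ^ k) eta.
Proof.
case: k => k hf f0; first exact: holomorphicX.
apply: holomorphicV; first exact: holomorphicX.
by rewrite expf_neq0.
Qed.

Lemma cvg_inv_nbhs eta : eta != 0 -> z^-1 @[z --> eta] --> eta^-1.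
Proof. by move=> /holomorphic_inv /holomorphic_continuous. Qed.

(** Limits along punctured neighbourhoods compose only when f avoids the value f eta near eta. *)
Lemma cvg_dnbhs (f : C -> C) eta : f z @[z --> eta] --> f eta ->
  (\forall z \near eta^', f z != f eta) -> f z @[z --> eta^'] --> (f eta)^'.
Proof.
move=> fc fneq A /fc hA.
have {}hA : \forall z \near eta^', f z != f eta -> A (f z) by exact: nbhs_dnbhs.
by move: hA fneq; apply: filterS2 => z hz /hz.
Qed.

Lemma cvg_inv_dnbhs eta : eta != 0 -> z^-1 @[z --> eta^'] --> (eta^-1)^'.
Proof.
move=> eta0; apply: (cvg_dnbhs (f := fun z => z^-1)); first exact: cvg_inv_nbhs.
apply: filterS (nbhs_dnbhs_neq eta) => z; apply: contra_neq.
exact: invr_inj.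
Qed.

End HolomorphicGerms.

(** * Orders of vanishing and meromorphic germs *)

Section Orders.
Context {R : realType}.
Local Notation C := (Cplx R).
Implicit Types (f g : C -> C) (eta z : C).

Lemma holomorphic_subr c eta : holomorphic_near (fun z : C => z - c) eta.
Proof.
exact: (holomorphicD (@holomorphic_id _ eta) (@holomorphic_cst _ (- c) eta)).
Qed.

Lemma dnbhs_subr_neq0 eta : \forall z \near eta^', z - eta != 0.
Proof. by apply: filterS (nbhs_dnbhs_neq eta) => z; rewrite subr_eq0. Qed.

Lemma near_eq_has_order f g eta k :
  (\forall z \near eta^', f z = g z) -> has_order g eta k -> has_order f eta k.
Proof.
move=> fg [h [hh h0 gh]]; exists h; split => //.
by apply: filterS2 fg gh => z ->.
Qed.

Lemma has_order_near_neq0 f eta k : has_order f eta k ->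
  \forall z \near eta^', f z != 0.
Proof.
move=> [g [hg g0 fg]].
have := nbhs_dnbhs (continuous_neq0 (holomorphic_continuous hg) g0).
move=> gn0; near=> z.
have -> : f z = (z - eta) ^ k * g z by near: z.
rewrite mulf_neq0 ?expfz_neq0 //; first by near: z; exact: dnbhs_subr_neq0.
by near: z.
Unshelve. all: by end_near. Qed.

(** If k < l, then g agrees near eta with (z - eta)^(l - k) h, and continuity forces g eta = 0. *)
Lemma has_order_le f eta k l : has_order f eta k -> has_order f eta l -> l <= k.
Proof.
move=> [g [hg g0 fg]] [h [hh h0 fh]]; rewrite leNgt; apply/negP => kl.
pose u z := (z - eta) ^+ `|l - k|%N * h z.
have hu : holomorphic_near u eta.
  exact: holomorphicM (holomorphicX _ (holomorphic_subr eta eta)) hh.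
have u0 : u eta = 0.
  by rewrite /u subrr expr0n absz_eq0 subr_eq0 gt_eqF // mul0r.
have ug : \forall z \near eta^', u z = g z.
  near=> z; have zeta : z - eta != 0.
    by near: z; exact: dnbhs_subr_neq0.
  apply: (mulfI (expfz_neq0 k zeta)); rewrite /u mulrA.
  have -> : (z - eta) ^+ `|l - k|%N = (z - eta) ^ (l - k).
    by rewrite -[in RHS](@gez0_abs (l - k)) // subr_ge0 ltW.
  rewrite -expfzDr // subrKC; transitivity (f z); first by symmetry; near: z.
  by near: z.
have := holomorphic_cvg_dnbhs hu; rewrite u0 => cu.
have cg : g z @[z --> eta^'] --> 0.
  by move: cu; apply: cvg_trans; apply: near_eq_cvg; apply: filterS ug => z ->.
have := holomorphic_cvg_dnbhs hg => cg'.
by move: g0; rewrite (cvg_unique _ cg' cg) // eqxx.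
Unshelve. all: by end_near. Qed.

Lemma has_order_uniq f eta k l : has_order f eta k -> has_order f eta l -> k = l.
Proof.
by move=> fk fl; apply/le_anti; rewrite (has_order_le fk fl) (has_order_le fl fk).
Qed.

Lemma has_order_ord f eta k : has_order f eta k -> ord f eta = k.
Proof.
move=> fk; rewrite /ord; case: xgetP => [l -> fl|/(_ k)//].
exact: has_order_uniq fl fk.
Qed.

Lemma has_order_div f g eta k l : has_order f eta k -> has_order g eta l ->
  has_order (fun z => f z / g z) eta (k - l).
Proof.
move=> [u [hu u0 fu]] [v [hv v0 gv]]; exists (fun z => u z / v z); split.
- exact: holomorphicM hu (holomorphicV hv v0).
- by rewrite mulf_neq0 ?invr_eq0.
- near=> z; have zeta : z - eta != 0.
    by near: z; exact: dnbhs_subr_neq0.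
  have -> : f z = (z - eta) ^ k * u z by near: z.
  have -> : g z = (z - eta) ^ l * v z by near: z.
  by rewrite invfM invr_expz expfzDr // mulrACA.
Unshelve. all: by end_near. Qed.

Lemma has_orderMl f g eta k : holomorphic_near g eta -> g eta != 0 ->
  has_order f eta k -> has_order (fun z => g z * f z) eta k.
Proof.
move=> hg g0 [u [hu u0 fu]]; exists (fun z => g z * u z); split.
- exact: holomorphicM hg hu.
- exact: mulf_neq0.
- by apply: filterS fu => z ->; rewrite mulrCA.
Qed.

Lemma has_order_horner (p : {poly C}) eta : p != 0 ->
  exists k, has_order (horner p) eta k.
Proof.
move=> p0; have [m [q q0 ->]] := multiplicity_XsubC p eta.
exists m, (horner q); split; [exact: holomorphic_horner|exact: (implyP q0)|].
by near=> z; rewrite !hornerE mulrC.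
Unshelve. all: by end_near. Qed.

Lemma holomorphic_comp_inv g eta : eta != 0 -> holomorphic_near g eta^-1 ->
  holomorphic_near (fun z => g z^-1) eta.
Proof.
move=> eta0 hg.
have := cvg_inv_nbhs eta0 hg; rewrite nbhs_filterE /=.
have : \forall z \near eta, z != 0 by apply: (@continuous_neq0 _ id).
apply: filterS2 => z z0 /derivable1_diffP dg; apply/derivable1_diffP.
have dV : differentiable (fun z : C => z^-1) z.
  by apply/derivable1_diffP; exact: nbhs_singleton (holomorphic_inv z0).
exact: (@differentiable_comp C C C C (fun z => z^-1) g z dV dg).
Qed.

(** The factor z^-1 - eta^-1 equals (z - eta) times -(z eta)^-1, and the latter is holomorphic and
    nonzero at eta. *)
Lemma has_order_comp_inv f eta k : eta != 0 -> has_order f eta^-1 k ->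
  has_order (fun z => f z^-1) eta k.
Proof.
move=> eta0 [g [hg g0 fg]]; exists (fun z => (- (z * eta)^-1) ^ k * g z^-1).
split.
- have ee0 : eta * eta != 0 by rewrite mulf_neq0.
  have hV := holomorphicN (holomorphicV (holomorphicM (@holomorphic_id _ eta)
    (@holomorphic_cst _ eta eta)) ee0).
  apply: holomorphicM (holomorphicXz k hV _) (holomorphic_comp_inv eta0 hg).
  by rewrite oppr_eq0 invr_eq0.
- by rewrite mulf_neq0 // expfz_neq0 // oppr_eq0 invr_eq0 mulf_neq0.
- have := cvg_inv_dnbhs eta0 fg; rewrite nbhs_filterE /= => {}fg.
  near=> z; have -> : f z^-1 = (z^-1 - eta^-1) ^ k * g z^-1 by near: z.
  have z0 : z != 0.
    by near: z; apply: nbhs_dnbhs; apply: (@continuous_neq0 _ id).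
  have -> : z^-1 - eta^-1 = (z - eta) * - (z * eta)^-1.
    apply: (mulIf (mulf_neq0 z0 eta0)).
    rewrite -mulrA mulNr mulVf ?mulf_neq0 // mulrN1 opprB mulrBl mulKf //.
    by rewrite [z * eta]mulrC mulKf.
  have zeta : z - eta != 0.
    by near: z; exact: dnbhs_subr_neq0.
  rewrite exprzMl ?mulrA // unitfE //.
  by rewrite oppr_eq0 invr_eq0 mulf_neq0.
Unshelve. all: by end_near. Qed.

Lemma holomorphic_meromorphic f eta : holomorphic_near f eta -> meromorphic_at f eta.
Proof.
move=> hf; exists 0%N, f; split => //; near=> z.
by rewrite expr0 invr1 mul1r.
Unshelve. all: by end_near. Qed.

Lemma near_eq_meromorphic f g eta :
  (\forall z \near eta^', f z = g z) -> meromorphic_at g eta -> meromorphic_at f eta.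
Proof.
move=> fg [n [h [hh gh]]]; exists n, h; split => //.
by apply: filterS2 fg gh => z ->.
Qed.

Lemma meromorphicM f g eta : meromorphic_at f eta -> meromorphic_at g eta ->
  meromorphic_at (fun z => f z * g z) eta.
Proof.
move=> [n [u [hu fu]]] [m [v [hv gv]]]; exists (n + m)%N, (fun z => u z * v z).
split; first exact: holomorphicM hu hv.
by apply: filterS2 fu gv => z -> ->; rewrite mulrACA exprD invfM.
Qed.

Lemma meromorphicD f g eta : meromorphic_at f eta -> meromorphic_at g eta ->
  meromorphic_at (fun z => f z + g z) eta.
Proof.
move=> [n [u [hu fu]]] [m [v [hv gv]]].
exists (n + m)%N, (fun z => (z - eta) ^+ m * u z + (z - eta) ^+ n * v z); split.
  exact: holomorphicD (holomorphicM (holomorphicX m (holomorphic_subr eta eta)) hu)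
    (holomorphicM (holomorphicX n (holomorphic_subr eta eta)) hv).
near=> z; have zeta : z - eta != 0.
  by near: z; exact: dnbhs_subr_neq0.
have -> : f z = (z - eta) ^- n * u z by near: z.
have -> : g z = (z - eta) ^- m * v z by near: z.
rewrite exprD invfM mulrDr !mulrA.
congr (_ * _ + _ * _); rewrite -?mulrA.
  by rewrite mulVf ?expf_neq0 // mulr1.
by rewrite mulrC -mulrA mulfV ?expf_neq0 // mulr1.
Unshelve. all: by end_near. Qed.

Lemma has_order_meromorphicV f eta k : has_order f eta k ->
  meromorphic_at (fun z => (f z)^-1) eta.
Proof.
move=> [g [hg g0 fg]]; case: k fg => k fg.
- exists k, (fun z => (g z)^-1); split; first exact: holomorphicV.
  by apply: filterS fg => z ->; rewrite invfM.
- apply: (near_eq_meromorphic (g := fun z => (z - eta) ^+ k.+1 * (g z)^-1)).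
    by apply: filterS fg => z ->; rewrite invfM NegzE -exprnN invrK.
  apply: holomorphic_meromorphic.
  exact: holomorphicM (holomorphicX _ (holomorphic_subr _ _)) (holomorphicV hg g0).
Qed.

End Orders.

(** * Continuity and local injectivity of complex powers of q *)

Section ComplexPowers.
Context {R : realType}.
Local Notation C := (Cplx R).
Local Open Scope complex_scope.
Local Notation Re := (@complex.Re R).
Local Notation Im := (@complex.Im R).
Implicit Types (q : nat) (s z w : C).

Lemma cpowD q z w : cpow q (z + w) = cpow q z * cpow q w.
Proof.
case: z w => [x y] [x' y']; rewrite /cpow /=; simpc.
rewrite !mulrDl expRD cosD sinD; congr (_ +i* _); ring.
Qed.

Lemma cpow0 q : cpow q 0 = 1 :> C.
Proof. by rewrite /cpow /= !mul0r expR0 cos0 sin0 mulr1 mulr0. Qed.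

Lemma cpow_neq0 q z : cpow q z != 0.
Proof.
apply/eqP => z0; have := cpowD q z (- z).
by rewrite subrr cpow0 z0 mul0r => /eqP; rewrite oner_eq0.
Qed.

Lemma cpowN q z : cpow q (- z) = (cpow q z)^-1.
Proof.
by apply: (mulfI (cpow_neq0 q z)); rewrite -cpowD subrr cpow0 mulfV ?cpow_neq0.
Qed.

Lemma cpowB q z w : cpow q (z - w) = cpow q z / cpow q w.
Proof. by rewrite cpowD cpowN. Qed.

Lemma cpowM_natl q n z : cpow q (n%:R * z) = cpow q z ^+ n.
Proof.
elim: n => [|n ih]; first by rewrite mul0r cpow0 expr0.
by rewrite -addn1 natrD mulrDl mul1r cpowD ih exprD expr1.
Qed.

Lemma cpow_rc q (x : R) : cpow q (rc x) = rc (expR (x * ln q%:R)).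
Proof. by rewrite /cpow /rc /= mul0r cos0 sin0 mulr1 mulr0. Qed.

Lemma cpow1 q : (0 < q)%N -> cpow q 1 = q%:R :> C.
Proof.
move=> q0; have -> : 1 = rc 1 :> C by [].
rewrite cpow_rc mul1r lnK ?posrE ?ltr0n //.
by rewrite /rc rmorph_nat.
Qed.

Lemma sqr_rc_sqrt_nat q : rc (Num.sqrt q%:R) ^+ 2 = q%:R :> C.
Proof. by rewrite /rc -rmorphXn /= sqr_sqrtr ?ler0n // rmorph_nat. Qed.

Lemma cpow_half q : (0 < q)%N -> cpow q (2^-1) = rc (Num.sqrt q%:R) :> C.
Proof.
move=> q0; have -> : 2^-1 = rc 2^-1 :> C by rewrite /rc fmorphV rmorph_nat.
rewrite cpow_rc; congr rc; apply/eqP.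
rewrite -(@eqrXn2 _ 2) ?expR_ge0 ?sqrtr_ge0 //.
rewrite -expRM_natl mulrA divff ?mul1r ?pnatr_eq0 // lnK ?posrE ?ltr0n //.
by rewrite sqr_sqrtr ?ler0n.
Qed.

(** For |y ln q| < pi the sine of y ln q vanishes only at y = 0; the real part then forces x = 0. *)
Lemma cpow_eq1 q (y x : R) : (1 < q)%N -> `|y * ln q%:R| < pi ->
  cpow q (x +i* y) = 1 -> x +i* y = 0.
Proof.
move=> q1; have lq : 0 < ln q%:R :> R by rewrite ln_gt0 // ltr1n.
set l := ln _ in lq *; rewrite /cpow -/l => ypi [].
have /negPf e0 : expR (x * l) != 0 by rewrite gt_eqF ?expR_gt0.
move=> ecos /eqP; rewrite mulf_eq0 e0 /= => /eqP sy.
have y0 : y * l = 0.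
  apply/eqP/negP => /negP yl0; have := sin_gt0_pi (x := `|y * l|).
  rewrite normr_gt0 yl0 ypi => /(_ isT).
  by case: (ler0P (y * l)) => _; rewrite ?sinN sy ?oppr0 ltxx.
move: ecos; rewrite y0 cos0 mulr1 -expR0 => /expR_inj /eqP.
move: y0 => /eqP; rewrite !mulf_eq0 (gt_eqF lq) !orbF => /eqP -> /eqP ->.
by [].
Qed.

Lemma normRe_le z : `|Re z| <= Re `|z|.
Proof.
rewrite normc_def /= -sqrtr_sqr ler_sqrt ?addr_ge0 ?sqr_ge0 //.
by rewrite lerDl sqr_ge0.
Qed.

Lemma normIm_le z : `|Im z| <= Re `|z|.
Proof.
rewrite normc_def /= -sqrtr_sqr ler_sqrt ?addr_ge0 ?sqr_ge0 //.
by rewrite lerDr sqr_ge0.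
Qed.

Lemma cvg_Re (T : Type) (F : set_system T) {FF : Filter F} (f : T -> C) z0 :
  f x @[x --> F] --> z0 -> Re (f x) @[x --> F] --> Re z0.
Proof.
move=> /cvgrPdist_lt fz; apply/cvgrPdist_lt => e e0.
have re0 : 0 < rc e by rewrite ltcE /= eqxx e0.
apply: filterS (fz _ re0) => x; rewrite ltcE => /andP[_].
by apply: le_lt_trans; rewrite -raddfB; exact: normRe_le.
Qed.

Lemma cvg_Im (T : Type) (F : set_system T) {FF : Filter F} (f : T -> C) z0 :
  f x @[x --> F] --> z0 -> Im (f x) @[x --> F] --> Im z0.
Proof.
move=> /cvgrPdist_lt fz; apply/cvgrPdist_lt => e e0.
have re0 : 0 < rc e by rewrite ltcE /= eqxx e0.
apply: filterS (fz _ re0) => x; rewrite ltcE => /andP[_].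
by apply: le_lt_trans; rewrite -raddfB; exact: normIm_le.
Qed.

Lemma near_Im (T : Type) (F : set_system T) {FF : Filter F} (f : T -> C) z0 (e : R) :
  f x @[x --> F] --> z0 -> 0 < e -> \forall x \near F, `|Im z0 - Im (f x)| < e.
Proof. by move=> /cvg_Im /cvgrPdist_lt; exact. Qed.

Lemma cvg_rc (T : Type) (F : set_system T) {FF : Filter F} (f : T -> R) (l : R) :
  f x @[x --> F] --> l -> rc (f x) @[x --> F] --> rc l.
Proof.
move=> /cvgrPdist_lt fl; apply/cvgrPdist_lt => e.
rewrite ltcE /= => /andP[/eqP e0 er]; apply: filterS (fl _ er) => x.
by rewrite /rc -rmorphB normc_def ltcE /= e0 eqxx expr0n addr0 sqrtr_sqr.
Qed.

Lemma cvg_cpow (T : Type) (F : set_system T) {FF : Filter F} q (f : T -> C) z0 :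
  f x @[x --> F] --> z0 -> cpow q (f x) @[x --> F] --> cpow q z0.
Proof.
move=> fz; set l : R := ln q%:R.
have e z : cpow q z = rc (expR (Re z * l) * cos (Im z * l)) +
     'i%C * rc (expR (Re z * l) * sin (Im z * l)).
  by case: z => x y; rewrite /cpow [LHS]complexE.
under eq_fun do rewrite e; rewrite e.
have cRe : expR (Re (f x) * l) @[x --> F] --> expR (Re z0 * l).
  apply: (cvg_comp (fun x => Re (f x) * l) expR _ (@continuous_expR R _)).
  exact: cvgMr_tmp (cvg_Re fz).
have cIm : Im (f x) * l @[x --> F] --> Im z0 * l by exact: cvgMr_tmp (cvg_Im fz).
have ccos := cvg_comp (fun x => Im (f x) * l) cos cIm (@continuous_cos R _).
have csin := cvg_comp (fun x => Im (f x) * l) sin cIm (@continuous_sin R _).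
apply: cvgD; first exact: cvg_rc (cvgM cRe ccos).
by apply: cvgMl_tmp; exact: cvg_rc (cvgM cRe csin).
Qed.

Lemma cpow_locally_injective q s : (1 < q)%N ->
  \forall z \near s^', cpow q z != cpow q s.
Proof.
move=> q1; have lq : 0 < ln q%:R :> R by rewrite ln_gt0 // ltr1n.
(* The periods of q^z are the multiples of 2 pi i / ln q; imaginary parts closer than pi / ln q
   exclude the nonzero ones. *)
have := @near_Im _ (nbhs s) (nbhs_filter s) id s _ cvg_id (divr_gt0 (pi_gt0 R) lq).
move=> /nbhs_dnbhs; have := dnbhs_subr_neq0 s; apply: filterS2 => z zs imz.
apply: contraNN zs => /eqP cz.
have : cpow q (z - s) = 1 by rewrite cpowB cz divff ?cpow_neq0.
case: z s {cz} imz => [x y] [x' y'] imz; simpc => /cpow_eq1 -> //.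
by rewrite normrM (gtr0_norm lq) -ltr_pdivlMr // distrC.
Qed.

End ComplexPowers.

(** * Scattering matrices *)

Section Jacobi.
Local Open Scope sesquilinear_scope.
Context {R : realType} {F : finFieldType} {K : laurentField F}.
Context {G : set (pgl K)} (hG : tree_lattice G) {d r : nat} (Y : cusped_quotient R G d r).
Local Notation C := (Cplx R).
Local Notation q := #|F|.
Local Notation a := (sqrt_q R F).
Implicit Types (mu zeta : C) (f phi : qvertex d r -> C) (alpha beta b : 'cV[C]_r).
Implicit Types (v w : 'I_d) (c : 'I_r) (i j : qvertex d r).

Lemma rcM (x y : R) : rc (x * y) = rc x * rc y. Proof. exact: rmorphM. Qed.

Lemma rc_neq0 (x : R) : x != 0 -> rc x != 0.
Proof. by move=> x0; rewrite /rc fmorph_eq0. Qed.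

Lemma sqr_sqrt_q : a ^+ 2 = q%:R.
Proof. exact: sqr_rc_sqrt_nat. Qed.

Lemma sqrt_q_neq0 : a != 0.
Proof.
rewrite -sqrf_eq0 sqr_sqrt_q pnatr_eq0 -lt0n ltnW //.
exact: card_residue_gt1.
Qed.

Lemma sqrt_lam_neq0 i : sqrt_lam Y i != 0.
Proof. by apply: rc_neq0; rewrite gt_eqF // sqrtr_gt0; exact: lam_gt0. Qed.

Definition sqrt_mult c : C := rc (Num.sqrt (cusp_mult Y c)).

Lemma sqrt_mult_neq0 c : sqrt_mult c != 0.
Proof. by apply: rc_neq0; rewrite gt_eqF // sqrtr_gt0; exact: cusp_mult_gt0. Qed.

Lemma sqr_sqrt_mult c : sqrt_mult c * sqrt_mult c = rc (cusp_mult Y c).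
Proof. by rewrite -rcM -expr2 sqr_sqrtr // ltW //; exact: cusp_mult_gt0. Qed.

(** The square root of detailed balance on the first cusp edge. It makes both entries of J along
    this edge equal to a times the square root of m_c. *)
Lemma sqrt_mult_lam c : sqrt_mult c * sqrt_lam Y (inl (cq_att Y c)) =
  a * sqrt_lam Y (inr (c, 0%N)).
Proof.
rewrite -!rcM -!sqrtrM ?ler0n //; last exact/ltW/cusp_mult_gt0.
by rewrite cusp_mult_lam.
Qed.

Lemma sqrt_lam_ray c n :
  sqrt_lam Y (inr (c, n)) = a * sqrt_lam Y (inr (c, n.+1)).
Proof.
rewrite -rcM -sqrtrM ?ler0n // !lam_ray; congr (rc (Num.sqrt _)).
by rewrite [in RHS]exprS invfM [in RHS]mulrCA mulVKf ?q_neq0 // lam_ray.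
Qed.

Lemma attach_adjoint : attach Y ^t* = (attach Y)^T.
Proof.
apply/matrixP => c v; rewrite !mxE rmorphM rmorph_nat; congr (_ * _).
by apply: geC0_conj; rewrite ler0c sqrtr_ge0.
Qed.

Lemma sqrt_q_conj : a^* = a.
Proof. by apply: geC0_conj; rewrite ler0c sqrtr_ge0. Qed.

Lemma Vmx_adjoint : Vmx Y *m Vmx Y ^t* = (a ^+ 2) *: (attach Y *m (attach Y)^T).
Proof.
rewrite /Vmx; have -> : (a *: attach Y) ^t* = a *: (attach Y)^T.
  rewrite -attach_adjoint; apply/matrixP => c v; rewrite !mxE.
  by rewrite [LHS]rmorphM; congr (_ * _); exact: sqrt_q_conj.
by rewrite -scalemxAl -scalemxAr scalerA expr2.
Qed.

Lemma H_CE v w : H_C Y v w =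
  sqrt_lam Y (inl v) * core_adj Y v w / sqrt_lam Y (inl w).
Proof.
rewrite mxE /jacobi adjop_core // [X in _ * (_ + X)]big1 ?addr0 => [|c _]; last first.
  by rewrite /delta !mulr0.
rewrite (bigD1 w) //= [X in _ * (_ + X)]big1 ?addr0 => [|w' /negPf w'w].
  by rewrite /delta eqxx mulr1 mulrA.
by rewrite /delta (_ : inl w' == inl w = false) ?mulr0 //; apply/eqP => -[]/eqP; rewrite w'w.
Qed.

Lemma jacobi_core phi v : jacobi Y phi (inl v) =
  \sum_w H_C Y v w * phi (inl w) + \sum_c Vmx Y v c * phi (inr (c, 0%N)).
Proof.
rewrite /jacobi adjop_core // mulrDr !mulr_sumr; congr (_ + _).
  by apply: eq_bigr => w _; rewrite H_CE !mulrA.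
rewrite big_mkcond; apply: eq_bigr => c _; rewrite !mxE [v == _]eq_sym.
case: eqP => [<-|_]; last by rewrite !mulr0 mul0r.
rewrite mulr1 -/(sqrt_mult c) -sqr_sqrt_mult.
have := sqrt_lam_neq0 (inr (c, 0%N)); have := sqrt_mult_lam c.
move: (sqrt_lam Y (inl _)) (sqrt_lam Y (inr _)) => sv s0.
move: (sqrt_mult c) (phi _) a => m p b h s00.
(* Only one of the two factors m is paired with sv, so that the square-root balance [h] cancels
   s0. *)
transitivity ((m * sv) * m * p / s0); first by ring.
by rewrite h; field.
Qed.

Lemma jacobi_ray0 phi c : jacobi Y phi (inr (c, 0%N)) =
  a * (sqrt_mult c * phi (inl (cq_att Y c)) + phi (inr (c, 1%N))).
Proof.
have h0 := sqrt_lam_neq0 (inr (c, 0%N)); have h1 := sqrt_lam_neq0 (inr (c, 1%N)).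
have hv := sqrt_lam_neq0 (inl (cq_att Y c)).
rewrite /jacobi adjop_ray /= mulrDr [RHS]mulrDr -sqr_sqrt_q; congr (_ + _).
  move: hv (sqrt_mult_lam c).
  move: (sqrt_lam Y (inl _)) (sqrt_lam Y (inr _)) => sv s0.
  move: (sqrt_mult c) (phi _) a => m p b hv h.
  transitivity ((b * s0) * b * p / sv); first by ring.
  by rewrite -h; field.
by rewrite sqrt_lam_ray mulrA mulfK.
Qed.

Lemma jacobi_rayS phi c n : jacobi Y phi (inr (c, n.+1)) =
  a * (phi (inr (c, n)) + phi (inr (c, n.+2))).
Proof.
have h1 := sqrt_lam_neq0 (inr (c, n.+1)).
have h2 := sqrt_lam_neq0 (inr (c, n.+2)).
have a0 := sqrt_q_neq0.
rewrite /jacobi adjop_ray /= mulrDr [RHS]mulrDr -sqr_sqrt_q; congr (_ + _).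
  rewrite (sqrt_lam_ray c n); field; by rewrite a0 h1.
by rewrite (sqrt_lam_ray c n.+1) mulrA mulfK.
Qed.

Lemma FmxE zeta : Fmx Y zeta = H_C Y - (@spectral_param R F zeta)%:M +
  (a / zeta) *: (attach Y *m (attach Y)^T).
Proof.
rewrite /Fmx Vmx_adjoint scalerA; congr (_ + _ *: _).
by rewrite expr2 mulrA divfK ?sqrt_q_neq0 // mulrC.
Qed.

End Jacobi.

(** * The identity between F and the symmetrized resonance matrix *)

Section Resonance.
Context {R : realType} {F : finFieldType} {K : laurentField F}.
Context {G : set (pgl K)} (hG : tree_lattice G) {d r : nat} (Y : cusped_quotient R G d r).
Local Notation C := (Cplx R).
Local Notation q := #|F|.
Local Notation a := (sqrt_q R F).
Local Notation spectral_param := (@spectral_param R F).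
Implicit Types (mu zeta : C) (f phi : qvertex d r -> C) (alpha beta b : 'cV[C]_r).
Implicit Types (v w : 'I_d) (c : 'I_r) (i j : qvertex d r).

Let a0 : a != 0. Proof. exact: sqrt_q_neq0. Qed.
Let two_a0 : 2 * a != 0. Proof. by rewrite mulf_neq0 ?pnatr_eq0. Qed.

Lemma attach_gram v w : (attach Y *m (attach Y)^T) v w =
  rc (\sum_(c | cq_att Y c == v) cusp_mult Y c) *+ (v == w).
Proof.
rewrite mxE; under eq_bigr => c _ do rewrite !mxE.
have [<-|vw] := eqVneq v w; last first.
  rewrite big1 // => c _; case: (v =P _) => [vc|_]; last by rewrite mulr0 mul0r.
  case: (w =P _) => [wc|_]; last by rewrite !mulr0.
  by case/eqP: vw; rewrite vc wc.
rewrite mulr1n /rc rmorph_sum /= [RHS]big_mkcond; apply: eq_bigr => c _.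
rewrite eq_sym; case: eqP => _; last by rewrite !mulr0.
by rewrite !mulr1; exact: sqr_sqrt_mult.
Qed.

Lemma core_U_unit : core_U Y \in unitmx.
Proof. by apply: (invmx_diag _).1 => v; rewrite mxE; exact: sqrt_lam_neq0. Qed.

Lemma Hres_symE mu v w : Hres_sym Y mu v w =
  sqrt_lam Y (inl v) * Hres Y mu v w / sqrt_lam Y (inl w).
Proof.
rewrite /Hres_sym /core_U diag_conjE ?mxE // => u.
by rewrite mxE; exact: sqrt_lam_neq0.
Qed.

Lemma det_Hres_sym mu : \det (Hres_sym Y mu) = \det (Hres Y mu).
Proof. by rewrite det_conj // core_U_unit. Qed.

Lemma Fmx_Hres mu : mu != 0 -> Fmx Y mu = (2 * a) *: Hres_sym Y mu.
Proof.
move=> mu0; have ha : (rc (Num.sqrt q%:R) : C) != 0 := a0.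
apply/matrixP => v w; rewrite FmxE [RHS]mxE Hres_symE /spectral_param.
rewrite [LHS]mxE [X in X + _]mxE H_CE // [X in _ + X]mxE attach_gram.
rewrite /Hres /Bmx !mxE.
have hv := sqrt_lam_neq0 hG Y (inl v); have hw := sqrt_lam_neq0 hG Y (inl w).
(* On the diagonal, conjugation by [core_U] is invisible and C C^* supplies the cusp term; off the
   diagonal only the conjugated adjacency entry remains. *)
have [vw|vw] := eqVneq v w.
  subst w; rewrite !mulr1n; move: (sqrt_lam Y _) (adjop _ _ _) (rc _) hv => x e m x0.
  by field; apply/and3P; split.
move: (sqrt_lam Y (inl v)) (sqrt_lam Y (inl w)) hv hw (adjop _ _ _) => x y x0 y0 e.
by rewrite !mulr0n; field; apply/and3P; split.
Qed.

End Resonance.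

(** * Reduction of the Jacobi eigenvalue equation to the core *)

Section ScatteringAlgebra.
Context {R : realType} {F : finFieldType} {K : laurentField F}.
Context {G : set (pgl K)} (hG : tree_lattice G) {d r : nat} (Y : cusped_quotient R G d r).
Local Notation C := (Cplx R).
Local Notation q := #|F|.
Local Notation a := (sqrt_q R F).
Local Notation spectral_param := (@spectral_param R F).
Implicit Types (mu zeta : C) (f phi : qvertex d r -> C) (alpha beta b : 'cV[C]_r).
Implicit Types (v w : 'I_d) (c : 'I_r) (i j : qvertex d r).

Let a0 : a != 0. Proof. exact: sqrt_q_neq0. Qed.
Let two_a0 : 2 * a != 0. Proof. by rewrite mulf_neq0 ?pnatr_eq0. Qed.

Definition core_values phi : 'cV[C]_d := \col_v phi (inl v).

Definition cusp_tail zeta alpha beta phi := forall c n, phi (inr (c, n)) =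
  zeta ^+ n.+1 * alpha c 0 + zeta ^- n.+1 * beta c 0.

(* The first ray equation says C^* u = alpha + beta; eliminating beta from the
   core equation then turns it into a linear system for u. *)
Lemma jacobi_eigenfunctionP zeta alpha beta phi : zeta != 0 ->
  jacobi_eigenfunction Y zeta alpha beta phi <->
  [/\ cusp_tail zeta alpha beta phi,
      (attach Y)^T *m core_values phi = alpha + beta &
      Fmx Y zeta *m core_values phi =
        (a * (zeta^-1 - zeta)) *: (attach Y *m alpha)].
Proof.
move=> z0.
have attachT c : ((attach Y)^T *m core_values phi) c 0 =
    sqrt_mult Y c * phi (inl (cq_att Y c)).
  rewrite mxE (bigD1 (cq_att Y c)) //= big1 ?addr0; last first.
    by move=> v /negPf vc; rewrite !mxE vc mulr0 mul0r.
  by rewrite !mxE eqxx mulr1.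
have core_eq v : cusp_tail zeta alpha beta phi ->
    (attach Y)^T *m core_values phi = alpha + beta ->
    (jacobi Y phi (inl v) = spectral_param zeta * phi (inl v)) <->
    (Fmx Y zeta *m core_values phi) v 0 =
        ((a * (zeta^-1 - zeta)) *: (attach Y *m alpha)) v 0.
  move=> tail ab.
  have -> : jacobi Y phi (inl v) = (H_C Y *m core_values phi) v 0 +
      a * (zeta * (attach Y *m alpha) v 0 + zeta^-1 * (attach Y *m beta) v 0).
    rewrite (jacobi_core hG) mxE; congr (_ + _).
      by apply: eq_bigr => w _; rewrite !mxE.
    rewrite !mxE !mulr_sumr -big_split mulr_sumr; apply: eq_bigr => c _ /=.
    rewrite tail expr1 [Vmx Y v c]mxE; ring.
  have -> : (attach Y *m beta) v 0 =
      (attach Y *m (attach Y)^T *m core_values phi) v 0 - (attach Y *m alpha) v 0.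
    by rewrite -mulmxA ab mulmxDr [X in _ = X - _]mxE addrAC subrr add0r.
  rewrite FmxE mulmxDl mulmxBl mul_scalar_mx -scalemxAl.
  have -> (A B D : 'cV[C]_d) (k l : C) : (A - k *: B + l *: D) v 0 =
    A v 0 - k * B v 0 + l * D v 0 by rewrite !mxE.
  rewrite [core_values phi v 0]mxE [in X in _ <-> _ = X]mxE.
  set A := (_ *m _) v 0; set B := (_ *m _ *m _) v 0; set D := (_ *m alpha) v 0.
  move: A B D (phi _) => A B D p.
  split=> [e|e].
    have -> : A = spectral_param zeta * p - a * (zeta * D + zeta^-1 * (B - D)).
      by rewrite -e; ring.
    by field.
  apply/eqP; rewrite -subr_eq0; apply/eqP.
  transitivity (A - spectral_param zeta * p + a / zeta * B - a * (zeta^-1 - zeta) * D).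
    by field.
  by rewrite e subrr.
split=> [[eig tail]|[tail ab core]].
  have ab : (attach Y)^T *m core_values phi = alpha + beta.
    apply/colP => c; rewrite attachT [RHS]mxE.
    have := eig (inr (c, 0%N)); rewrite (jacobi_ray0 hG) !tail.
    rewrite /Defs.spectral_param -mulrA => /(mulfI a0) e.
    apply: (addIr (zeta ^+ 2 * alpha c 0 + zeta ^- 2 * beta c 0)); rewrite e.
    by field.
  by split=> //; apply/colP => v; apply/core_eq.
split=> // -[v|[c [|n]]].
- by apply/core_eq => //; rewrite core.
- rewrite (jacobi_ray0 hG) -attachT ab !tail [X in _ * (X + _)]mxE.
  by rewrite /Defs.spectral_param; field.
- rewrite (jacobi_rayS hG) !tail /Defs.spectral_param.
  rewrite !exprSr; field; by rewrite z0 expf_neq0.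
Qed.

End ScatteringAlgebra.

Section ScatteringMatrices.
Context {R : realType} {F : finFieldType} {K : laurentField F}.
Context {G : set (pgl K)} (hG : tree_lattice G) {d r : nat} (Y : cusped_quotient R G d r).
Local Notation C := (Cplx R).
Local Notation q := #|F|.
Local Notation a := (sqrt_q R F).
Local Notation spectral_param := (@spectral_param R F).
Implicit Types (mu zeta s : C) (f phi : qvertex d r -> C) (alpha beta b : 'cV[C]_r).
Implicit Types (v w : 'I_d) (c : 'I_r) (i j : qvertex d r).

Let a0 : a != 0. Proof. exact: sqrt_q_neq0. Qed.
Let two_a0 : 2 * a != 0. Proof. by rewrite mulf_neq0 ?pnatr_eq0. Qed.

Lemma Fmx_unit mu : mu != 0 -> (Fmx Y mu \in unitmx) = (\det (Hres Y mu) != 0).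
Proof.
move=> mu0. rewrite (Fmx_Hres hG _ mu0). rewrite -(det_Hres_sym hG).
rewrite unitmxE detZ.
rewrite unitfE.
by rewrite mulf_eq0 negb_or expf_neq0.
Qed.

Lemma S_formula_Fmx mu : mu != 0 -> Fmx Y mu \in unitmx -> S_formula Y mu =
  - 1%:M + (a * (mu^-1 - mu)) *: ((attach Y)^T *m invmx (Fmx Y mu) *m attach Y).
Proof.
move=> mu0; rewrite (Fmx_Hres hG _ mu0) => Fu.
have Hu : Hres_sym Y mu \in unitmx.
  by rewrite unitmxZ ?unitfE // in Fu.
rewrite /S_formula attach_adjoint.
rewrite (invmxZl two_a0 Hu).
rewrite -scalemxAr -scalemxAl scalerA.
congr (_ + _ *: _).
have ha : (rc (Num.sqrt q%:R) : C) != 0 := a0.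
by field; apply/andP; split.
Qed.

Lemma jacobi_eigenfunction_unique zeta alpha : zeta != 0 -> Fmx Y zeta \in unitmx ->
  (exists! phi, exists beta, jacobi_eigenfunction Y zeta alpha beta phi) /\
  forall phi beta, jacobi_eigenfunction Y zeta alpha beta phi ->
    beta = S_formula Y zeta *m alpha.
Proof.
move=> z0 Fu; set u := (a * (zeta^-1 - zeta)) *: (invmx (Fmx Y zeta) *m (attach Y *m alpha)).
have betaE : S_formula Y zeta *m alpha = (attach Y)^T *m u - alpha.
  rewrite S_formula_Fmx // mulmxDl mulNmx mul1mx addrC -scalemxAl -scalemxAr.
  by rewrite !mulmxA.
have eig phi beta : jacobi_eigenfunction Y zeta alpha beta phi ->
    core_values phi = u /\ beta = S_formula Y zeta *m alpha.
  move=> /(jacobi_eigenfunctionP hG _ _ _ _ z0)[tail ab Fu'].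
  have cu : core_values phi = u by rewrite /u scalemxAr -Fu' mulKmx.
  by rewrite betaE -cu ab addrC addKr.
split; last by move=> phi beta /eig[].
pose phi (i : qvertex d r) : C := match i with inl v => u v 0
  | inr (c, n) => zeta ^+ n.+1 * alpha c 0 + zeta ^- n.+1 * (S_formula Y zeta *m alpha) c 0
  end.
have phiu : core_values phi = u by apply/colP => v; rewrite mxE.
exists phi; split.
  exists (S_formula Y zeta *m alpha); apply/jacobi_eigenfunctionP => //.
  rewrite phiu; split=> //; first by rewrite betaE addrC subrK.
  by rewrite /u -scalemxAr mulKVmx.
move=> phi' [beta eig']; have [cu bE] := eig _ _ eig'.
have [_ tail] := eig'; apply/funext => -[v|[c n]].
  by have /colP/(_ v) := cu; rewrite mxE.
by rewrite tail bE.
Qed.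

Lemma mulmx_cV_inj m n (M N : 'M[C]_(m, n)) :
  (forall v : 'cV[C]_n, M *m v = N *m v) -> M = N.
Proof.
move=> h; apply/matrixP => i j; have /colP/(_ i) := h (delta_mx j 0).
by rewrite -!colE !mxE.
Qed.

Lemma jacobi_scattering_S_formula zeta : zeta != 0 -> zeta != 1 -> zeta != -1 ->
  \det (Hres Y zeta) != 0 -> jacobi_scattering_at Y zeta (S_formula Y zeta).
Proof.
move=> z0 z1 zN1; rewrite -Fmx_unit // => Fu; split=> // alpha.
exact: jacobi_eigenfunction_unique.
Qed.

(** The matrix picked by [xget] is pinned down because an eigenfunction exists for every alpha, and
    both matrices compute its beta. *)
Lemma SjacE zeta : zeta != 0 -> zeta != 1 -> zeta != -1 ->
  \det (Hres Y zeta) != 0 -> Sjac Y zeta = S_formula Y zeta.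
Proof.
move=> z0 z1 zN1 D0; have h := jacobi_scattering_S_formula z0 z1 zN1 D0.
rewrite /Sjac; case: xgetP => [M _ [_ _ _ Fu hM]|/(_ _ h)//].
apply: mulmx_cV_inj => alpha; have [[phi [[beta eig] _]] _] := hM alpha.
have [_ _ _ _ /(_ alpha)[_ h']] := h.
by rewrite -(h' _ _ eig) -(proj2 (hM alpha) _ _ eig).
Qed.

(* Sylvester's identity reduces this to
   [H - (mu^-1 - mu)/2 C C^* = Hres_sym mu^-1] for [H = Hres_sym mu]. *)
Lemma det_S_formula mu : mu != 0 -> \det (Hres Y mu) != 0 ->
  \det (S_formula Y mu) = detS_formula Y mu.
Proof.
move=> mu0 D0; rewrite /S_formula attach_adjoint /detS_formula.
set k := (mu^-1 - mu) / 2; set H := Hres_sym Y mu.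
have Hu : H \in unitmx by rewrite unitmxE unitfE (det_Hres_sym hG).
have -> : - 1%:M + k *: ((attach Y)^T *m invmx H *m attach Y) =
    - (1%:M - (k *: ((attach Y)^T *m invmx H)) *m attach Y).
  by rewrite opprB addrC scalemxAl.
rewrite -scaleN1r detZ det_1B_mulmx; congr (_ * _).
have Hinv : Hres_sym Y mu^-1 = (1%:M - attach Y *m (k *: ((attach Y)^T *m invmx H))) *m H.
  apply: (scalerI two_a0); rewrite -(Fmx_Hres hG) ?invr_eq0 //.
  rewrite mulmxBl mul1mx scalerBr -(Fmx_Hres hG) // -mulmxA -scalemxAl mulmxKV //.
  rewrite -scalemxAr !FmxE invrK scalerA /Defs.spectral_param invrK addrAC [mu^-1 + mu]addrC.
  rewrite -[RHS]addrA -scaleNr -scalerDl addrAC; congr (_ + _ *: _).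
  have ha : (rc (Num.sqrt q%:R) : C) != 0 := a0.
  by rewrite /k; field.
rewrite -(det_Hres_sym hG Y mu^-1) Hinv det_mulmx (det_Hres_sym hG Y mu).
by rewrite (mulfK D0).
Qed.

End ScatteringMatrices.

(** * Eisenstein eigenfunctions and the constant-term matrix *)

Section ConstantTerms.
Context {R : realType} {F : finFieldType} {K : laurentField F}.
Context {G : set (pgl K)} (hG : tree_lattice G) {d r : nat} (Y : cusped_quotient R G d r).
Local Notation C := (Cplx R).
Local Notation q := #|F|.
Local Notation a := (sqrt_q R F).
Implicit Types (mu zeta s : C) (f phi : qvertex d r -> C) (alpha beta b : 'cV[C]_r).
Implicit Types (v w : 'I_d) (c : 'I_r) (i j : qvertex d r).

Let a0 : a != 0. Proof. exact: sqrt_q_neq0. Qed.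

Let q_gt0 : (0 < q)%N. Proof. by rewrite ltnW // card_residue_gt1. Qed.

Lemma mu_of_neq0 s : mu_of F s != 0.
Proof. exact: cpow_neq0. Qed.

Lemma cpow_mu_of s : cpow q s = a * mu_of F s.
Proof. by rewrite /mu_of cpowB cpow_half // mulrC divfK. Qed.

Lemma cpow_1B_mu_of s : cpow q (1 - s) = a / mu_of F s.
Proof.
rewrite cpowB cpow1 // cpow_mu_of -(sqr_sqrt_q (R := R)) invfM expr2.
by rewrite mulrA mulfK.
Qed.

Lemma cpow_neq_1B s : (cpow q s != cpow q (1 - s)) =
  (mu_of F s != 1) && (mu_of F s != -1).
Proof.
have m0 := mu_of_neq0 s; rewrite cpow_mu_of cpow_1B_mu_of (inj_eq (mulfI a0)).
rewrite -(inj_eq (mulIf m0)) mulVf // -expr2 -negb_or -sqrf_eq1 //.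
Qed.

(** The part of lambda(c, n)^(1/2) that does not depend on n. It differs from the entry of W^(1/2)
    by the scalar (q + 1)^(1/2), which cancels in the conjugation. *)
Definition cusp_weight c : C := rc (Num.sqrt (cq_w Y c * (q%:R + 1))).

Lemma cusp_weight_neq0 c : cusp_weight c != 0.
Proof.
by apply: rc_neq0; rewrite gt_eqF // sqrtr_gt0 mulr_gt0 ?cq_w_gt0.
Qed.

Lemma sqrt_lam_cusp c n : sqrt_lam Y (inr (c, n)) = cusp_weight c * a ^- n.+1.
Proof.
elim: n => [|n ih].
  apply: (mulfI a0); rewrite -(sqrt_mult_lam hG) -!rcM -sqrtrM; last exact/ltW/cusp_mult_gt0.
  by rewrite cusp_mult_lam_w // expr1 mulrCA mulfV ?mulr1.
apply: (mulfI a0); rewrite -(sqrt_lam_ray Y) ih [in RHS]exprS invfM.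
by rewrite [RHS]mulrCA mulVKf.
Qed.

Definition weight_mx : 'M[C]_r := diag_mx (\row_c cusp_weight c).

Lemma weight_mx_unit : weight_mx \in unitmx.
Proof. by apply: (invmx_diag _).1 => c; rewrite mxE cusp_weight_neq0. Qed.

Lemma weight_mxE b c : (weight_mx *m b) c 0 = cusp_weight c * b c 0.
Proof. by rewrite mul_diag_mx !mxE. Qed.

Lemma Saut_formula_weight mu :
  Saut_formula Y mu = invmx weight_mx *m S_formula Y mu *m weight_mx.
Proof.
have W0 c : (\row_c rc (Num.sqrt (cq_w Y c)) : 'rV[C]_r) 0 c != 0.
  by rewrite mxE; apply: rc_neq0; rewrite gt_eqF // sqrtr_gt0 cq_w_gt0.
have [Wu _] := invmx_diag W0.
have q10 : (rc (Num.sqrt (q%:R + 1)) : C) != 0.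
  by apply: rc_neq0; rewrite gt_eqF // sqrtr_gt0 addr_gt0 ?ltr01 // ltr0n.
have -> : weight_mx = rc (Num.sqrt (q%:R + 1)) *: sqrt_W Y.
  apply/matrixP => i j; rewrite !mxE mulrnAr; congr (_ *+ _).
  by rewrite /cusp_weight sqrtrM ?rcM 1?mulrC // ltW // cq_w_gt0.
rewrite (invmxZl q10 Wu) -!scalemxAl -scalemxAr scalerA mulVf //.
by rewrite scale1r.
Qed.

Lemma eisenstein_jacobi s b beta f :
  eisenstein_eigenfunction Y s b beta f <->
  jacobi_eigenfunction Y (mu_of F s) (weight_mx *m b) (weight_mx *m beta)
    (fun i => sqrt_lam Y i * f i).
Proof.
have m0 := mu_of_neq0 s.
have jE i : jacobi Y (fun i => sqrt_lam Y i * f i) i = sqrt_lam Y i * adjop Y f i.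
  rewrite /jacobi; congr (_ * adjop Y _ i); apply/funext => j.
  by rewrite mulKf // sqrt_lam_neq0.
have eigE i : (jacobi Y (fun i => sqrt_lam Y i * f i) i =
    @spectral_param R F (mu_of F s) * (sqrt_lam Y i * f i)) <->
    (adjop Y f i = (cpow q s + cpow q (1 - s)) * f i).
  rewrite jE cpow_mu_of cpow_1B_mu_of -mulrDr -/(@spectral_param R F _) mulrCA.
  by split=> [/(mulfI (sqrt_lam_neq0 hG Y i))|->].
have tailE c n : (f (inr (c, n)) = cpow q (n.+1%:R * s) * b c 0 +
      cpow q (n.+1%:R * (1 - s)) * beta c 0) <->
   (sqrt_lam Y (inr (c, n)) * f (inr (c, n)) =
    mu_of F s ^+ n.+1 * (weight_mx *m b) c 0 +
    mu_of F s ^- n.+1 * (weight_mx *m beta) c 0).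
  have -> : mu_of F s ^+ n.+1 * (weight_mx *m b) c 0 +
      mu_of F s ^- n.+1 * (weight_mx *m beta) c 0 = sqrt_lam Y (inr (c, n)) *
    (cpow q (n.+1%:R * s) * b c 0 + cpow q (n.+1%:R * (1 - s)) * beta c 0).
    (* Here q^(ns) = (a mu)^n and q^(n(1-s)) = (a / mu)^n; the factor a^-n of lambda^(1/2) cancels
       a^n in both. *)
    rewrite !weight_mxE !cpowM_natl cpow_mu_of cpow_1B_mu_of sqrt_lam_cusp.
    rewrite !exprMn exprVn mulrDr.
    have an0 : a ^+ n.+1 != 0 by rewrite expf_neq0.
    move: (a ^+ n.+1) an0 (mu_of F s ^+ n.+1) (cusp_weight c) => A A0 m w.
    congr (_ + _).
      transitivity (w * (A^-1 * A) * m * b c 0); last by ring.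
      by rewrite mulVf // mulr1 [m * _]mulrCA mulrA.
    transitivity (w * (A^-1 * A) * m^-1 * beta c 0); last by ring.
    by rewrite mulVf // mulr1 [m^-1 * _]mulrCA mulrA.
  by split=> [->//|/(mulfI (sqrt_lam_neq0 hG Y _))].
by split=> -[eig tail]; split=> *; first [exact/eigE|exact/tailE].
Qed.

Lemma constant_term_formula s : mu_of F s != 1 -> mu_of F s != -1 ->
  \det (Hres Y (mu_of F s)) != 0 ->
  constant_term_at Y s (Saut_formula Y (mu_of F s)).
Proof.
move=> m1 mN1 D0; have m0 := mu_of_neq0 s.
have Fu : Fmx Y (mu_of F s) \in unitmx by rewrite (Fmx_unit hG _ m0).
have Wu := weight_mx_unit.
split; first by rewrite cpow_neq_1B m1.
move=> b; have [[phi [[alpha eig] uniq_phi]] hbeta] :=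
  jacobi_eigenfunction_unique hG (weight_mx *m b) m0 Fu.
have slK (g : qvertex d r -> C) : (fun i => sqrt_lam Y i * ((sqrt_lam Y i)^-1 * g i)) = g.
  by apply/funext => i; rewrite mulVKf // sqrt_lam_neq0.
split.
  exists (fun i => (sqrt_lam Y i)^-1 * phi i); split.
    exists (invmx weight_mx *m alpha); apply/eisenstein_jacobi.
    by rewrite mulKVmx // slK.
  move=> f [beta /eisenstein_jacobi eigf].
  have -> : phi = fun i => sqrt_lam Y i * f i by apply: uniq_phi; exists (weight_mx *m beta).
  by apply/funext => i; rewrite mulKf // sqrt_lam_neq0.
move=> f beta /eisenstein_jacobi /hbeta e.
by rewrite Saut_formula_weight -!mulmxA -e mulKmx.
Qed.

(* A vector in the kernel of F(mu) would extend to an eigenfunction without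
   incoming term, against uniqueness for b = 0. *)
Lemma constant_term_at_regular s M : constant_term_at Y s M ->
  \det (Hres Y (mu_of F s)) != 0.
Proof.
move=> [_ hM]; have m0 := mu_of_neq0 s.
rewrite -(Fmx_unit hG _ m0); have Wu := weight_mx_unit.
have [[f0 [_ uniq_f]] _] := hM 0.
rewrite unitmxE unitfE -det_tr; apply/det0P => -[u u0 uF].
have Fu0 : Fmx Y (mu_of F s) *m u^T = 0.
  by apply: (can_inj trmxK); rewrite trmx_mul trmxK uF trmx0.
have eigen0 (x : 'cV[C]_d) : Fmx Y (mu_of F s) *m x = 0 ->
    exists2 f, (exists beta, eisenstein_eigenfunction Y s 0 beta f) &
      forall v, f (inl v) = (sqrt_lam Y (inl v))^-1 * x v 0.
  move=> Fx0; set beta := (attach Y)^T *m x.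
  pose phi (i : qvertex d r) : C := match i with inl v => x v 0
    | inr (c, n) => mu_of F s ^+ n.+1 * (0 : 'cV[C]_r) c 0 + mu_of F s ^- n.+1 * beta c 0
    end.
  exists (fun i => (sqrt_lam Y i)^-1 * phi i) => //.
  exists (invmx weight_mx *m beta); apply/eisenstein_jacobi.
  rewrite mulmx0 mulKVmx //.
  have -> : (fun i => sqrt_lam Y i * ((sqrt_lam Y i)^-1 * phi i)) = phi.
    by apply/funext => i; rewrite mulVKf // sqrt_lam_neq0.
  have px : core_values phi = x by apply/colP => v; rewrite mxE.
  apply/(jacobi_eigenfunctionP hG _ _ _ _ m0); rewrite px add0r mulmx0 scaler0.
  by split.
have [f1 h1 f1E] := eigen0 _ Fu0.
have [f2 h2 f2E] := eigen0 0 (mulmx0 _ _).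
have f12 : f1 = f2 by rewrite -(uniq_f _ h1) (uniq_f _ h2).
case/eqP: u0; apply/rowP => v; rewrite mxE.
have := f1E v; rewrite f12 f2E !mxE mulr0 => /esym/eqP.
by rewrite mulf_eq0 invr_eq0 (negPf (sqrt_lam_neq0 hG Y _)) => /eqP.
Qed.

Lemma SautE s : mu_of F s != 1 -> mu_of F s != -1 ->
  \det (Hres Y (mu_of F s)) != 0 -> Saut Y s = Saut_formula Y (mu_of F s).
Proof.
move=> m1 mN1 D0; have h := constant_term_formula m1 mN1 D0.
rewrite /Saut; case: xgetP => [M _ [_ hM]|/(_ _ h)//].
apply: mulmx_cV_inj => b; have [[f [[beta eig] _]] h1] := hM b.
have [_ /(_ b)[_ h2]] := h.
by rewrite -(h1 _ _ eig) -(h2 _ _ eig).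
Qed.

(** Makes the default value explicit, for comparing two constant-term matrices at parameters where
    neither is defined. *)
Lemma Saut_exceptional s : (forall M, ~ constant_term_at Y s M) -> Saut Y s = 0.
Proof. by move=> h; rewrite /Saut; case: xgetP => // M _ /h. Qed.

End ConstantTerms.

(** * Meromorphic continuation and rigidity *)

Section ResonanceDeterminant.
Context {R : realType} {F : finFieldType} {K : laurentField F}.
Context {G : set (pgl K)} (hG : tree_lattice G) {d r : nat} (Y : cusped_quotient R G d r).
Local Notation C := (Cplx R).
Local Notation a := (sqrt_q R F).
Implicit Types (mu eta z : C).

Lemma nbhs_neq eta c : eta != c -> \forall z \near eta, z != c.
Proof.
rewrite -subr_eq0 => /(continuous_neq0 (holomorphic_continuous (holomorphic_subr c eta))).
by apply: filterS => z; rewrite subr_eq0.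
Qed.

Lemma dnbhs_neq eta c : \forall z \near eta^', z != c.
Proof.
have [->|ec] := eqVneq eta c; last exact/nbhs_dnbhs/nbhs_neq.
by apply: filterS (dnbhs_subr_neq0 c) => z; rewrite subr_eq0.
Qed.

Lemma holomorphicMl (k : C) (f : C -> C) eta : holomorphic_near f eta ->
  holomorphic_near (fun z => k * f z) eta.
Proof. by move=> hf; exact: holomorphicM (@holomorphic_cst _ k eta) hf. Qed.

Let mult v : C := rc (\sum_(c | cq_att Y c == v) cusp_mult Y c).

Lemma HresE mu v w : Hres Y mu v w = (2 * a)^-1 * core_adj Y v w +
  ((2 * a)^-1 * mult v * a * mu^-1 - 2^-1 * (mu + mu^-1)) *+ (v == w).
Proof.
rewrite !mxE -/(mult v) mulrDr -addrA mulrnBl; congr (_ + (_ - _)).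
  by rewrite mulrnAr !mulrA.
by rewrite mulrC.
Qed.

Lemma Hres_holomorphic v w eta : eta != 0 ->
  holomorphic_near (fun z => Hres Y z v w) eta.
Proof.
move=> eta0; apply: eq_holomorphic => [z|]; first exact: HresE.
have hV := holomorphic_inv eta0; have hI := @holomorphic_id R eta.
have hsum := holomorphicD (holomorphicMl ((2 * a)^-1 * mult v * a) hV)
  (holomorphicN (holomorphicMl 2^-1 (holomorphicD hI hV))).
have [vw|vw] := eqVneq v w.
  exact: holomorphicD (@holomorphic_cst _ ((2 * a)^-1 * core_adj Y v w) eta) hsum.
exact: holomorphicD (@holomorphic_cst _ ((2 * a)^-1 * core_adj Y v w) eta)
  (@holomorphic_cst _ 0 eta).
Qed.

Lemma det_Hres_holomorphic eta : eta != 0 ->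
  holomorphic_near (fun z => \det (Hres Y z)) eta.
Proof. by move=> eta0; apply: holomorphic_det => v w; exact: Hres_holomorphic. Qed.

(* [z *: Hres z^-1] is polynomial in z, with value -1/2 at z = 0. *)
Lemma det_Hres_nontrivial : exists2 z, z != 0 & \det (Hres Y z) != 0.
Proof.
pose M (z : C) : 'M[C]_d := \matrix_(v, w) ((2 * a)^-1 * core_adj Y v w * z +
  ((2 * a)^-1 * mult v * a * z ^+ 2 - 2^-1 * (1 + z ^+ 2)) *+ (v == w)).
have hM : holomorphic_near (fun z => \det (M z)) 0.
  apply: holomorphic_det => v w.
  apply: eq_holomorphic => [z|]; first by rewrite mxE.
  have hI := @holomorphic_id R 0; have h2 := holomorphicX 2 hI.
  have hsum := holomorphicD (holomorphicMl ((2 * a)^-1 * mult v * a) h2)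
    (holomorphicN (holomorphicMl 2^-1 (holomorphicD (@holomorphic_cst R 1 0) h2))).
  have hc := holomorphicMl ((2 * a)^-1 * core_adj Y v w) hI.
  have [vw|vw] := eqVneq v w; first exact: holomorphicD hc hsum.
  exact: holomorphicD hc (@holomorphic_cst _ 0 0).
have M0 : \det (M 0) != 0.
  have -> : M 0 = (- 2^-1)%:M.
    apply/matrixP => v w; rewrite !mxE expr0n !mulr0 add0r addr0 mulr1.
    by rewrite sub0r.
  by rewrite det_scalar expf_neq0 // oppr_eq0 invr_eq0 pnatr_eq0.
have := nbhs_dnbhs (continuous_neq0 (holomorphic_continuous hM) M0).
have := dnbhs_neq 0 0 => h1 h2.
have [z [z0 Mz]] := @filter_ex _ _ (Proper_dnbhs_numFieldType (0 : C)) _ (filterI h1 h2).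
exists z^-1; first by rewrite invr_eq0.
have MH : M z = z *: Hres Y z^-1.
  apply/matrixP => v w; rewrite [RHS]mxE HresE mxE invrK [RHS]mulrDr; congr (_ + _).
    by rewrite mulrC.
  rewrite mulrnAr; congr (_ *+ _).
  by rewrite mulrBr -!mulrA; congr (_ - _); [ring|field].
by move: Mz; rewrite MH detZ mulf_eq0 negb_or => /andP[].
Qed.

(** Since z H_res(z) has polynomial entries, det H_res(z) is z^-d times a polynomial, which is
    nonzero by [det_Hres_nontrivial]; its root multiplicity at eta is the order. *)
Lemma det_Hres_has_order eta : eta != 0 ->
  exists k, has_order (fun z => \det (Hres Y z)) eta k.
Proof.
move=> eta0.
pose N : 'M[{poly C}]_d := \matrix_(v, w) (((2 * a)^-1 * core_adj Y v w)%:P * 'X +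
  (((2 * a)^-1 * mult v * a)%:P - (2^-1)%:P * ('X ^+ 2 + 1)) *+ (v == w)).
have detN z : z != 0 -> \det (Hres Y z) = z ^- d * (\det N).[z].
  move=> z0; have -> : (\det N).[z] = \det (z *: Hres Y z).
    rewrite -/(horner_eval z _) -det_map_mx; congr (\det _).
    apply/matrixP => v w; rewrite mxE [N v w]mxE [RHS]mxE HresE /= /horner_eval hornerD hornerMn.
    rewrite !hornerE [RHS]mulrDr; congr (_ + _); first by rewrite mulrC.
    by rewrite mulrnAr; congr (_ *+ _); move: (_ * mult v * a) => m; field.
  by rewrite detZ mulKf // expf_neq0.
have N0 : \det N != 0.
  have [z z0 Hz] := det_Hres_nontrivial.
  by apply: contraNneq Hz => N0; rewrite detN // N0 horner0 mulr0.
have [k hk] := has_order_horner eta N0; exists k.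
have hV : holomorphic_near (fun z : C => z ^- d) eta.
  by apply: holomorphicV; [exact: holomorphicX (@holomorphic_id R eta)|rewrite expf_neq0].
have V0 : eta ^- d != 0 by rewrite invr_eq0 expf_neq0.
apply: near_eq_has_order (has_orderMl hV V0 hk).
by apply: filterS (dnbhs_neq eta 0) => z; exact: detN.
Qed.

Lemma det_Hres_near_neq0 eta : eta != 0 -> \forall z \near eta^', \det (Hres Y z) != 0.
Proof. by move=> /det_Hres_has_order[k]; exact: has_order_near_neq0. Qed.

Lemma Fmx_holomorphic i j eta : eta != 0 -> holomorphic_near (fun z => Fmx Y z i j) eta.
Proof.
move=> eta0.
have h := holomorphicMl (2 * a) (holomorphicMl (sqrt_lam Y (inl i))
  (holomorphicM (Hres_holomorphic i j eta0)
     (@holomorphic_cst R (sqrt_lam Y (inl j))^-1 eta))).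
apply: near_eq_holomorphic h; apply: filterS (nbhs_neq eta0) => z z0.
by rewrite (Fmx_Hres hG Y z0) mxE (Hres_symE hG) -!mulrA.
Qed.

(** Inverting through the adjugate leaves det H_res as the only denominator that can vanish away
    from 0. *)
Let numerator z i j := ((attach Y)^T *m \adj (Hres_sym Y z) *m attach Y) i j.

Lemma S_formulaE z i j : \det (Hres Y z) != 0 ->
  S_formula Y z i j = - (i == j)%:R +
    2^-1 * (z^-1 - z) * numerator z i j * (\det (Hres Y z))^-1.
Proof.
move=> Dz; rewrite /S_formula attach_adjoint /invmx.
rewrite unitmxE unitfE (det_Hres_sym hG) Dz.
rewrite -scalemxAr -scalemxAl 4!mxE [X in _ + _ * X]mxE -/(numerator z i j).
by congr (_ + _); ring.
Qed.

Lemma numerator_holomorphic i j eta : eta != 0 ->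
  holomorphic_near (fun z => numerator z i j) eta.
Proof.
move=> eta0; have hsym u v : holomorphic_near (fun z => Hres_sym Y z u v) eta.
  have h := holomorphicMl (sqrt_lam Y (inl u))
    (holomorphicM (Hres_holomorphic u v eta0)
     (@holomorphic_cst R (sqrt_lam Y (inl v))^-1 eta)).
  by apply: eq_holomorphic h => z; rewrite (Hres_symE hG) -!mulrA.
have hadj u v : holomorphic_near (fun z => \adj (Hres_sym Y z) u v) eta.
  apply: eq_holomorphic => [z|]; first by rewrite mxE.
  apply: holomorphicMl; apply: holomorphic_det => k l.
  by apply: eq_holomorphic (hsym (lift v k) (lift u l)) => z; rewrite !mxE.
have hrow v : holomorphic_near (fun z => ((attach Y)^T *m \adj (Hres_sym Y z)) i v) eta.
  apply: eq_holomorphic => [z|]; first by rewrite mxE.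
  by apply: holomorphic_sum => u _; exact: holomorphicM (@holomorphic_cst R _ eta) (hadj u v).
have nE z : numerator z i j =
    \sum_v ((attach Y)^T *m \adj (Hres_sym Y z)) i v * attach Y v j.
  by rewrite /numerator mxE.
apply: (eq_holomorphic nE); apply: holomorphic_sum => v _.
exact: holomorphicM (hrow v) (@holomorphic_cst R (attach Y v j) eta).
Qed.

Lemma half_diff_holomorphic eta : eta != 0 ->
  holomorphic_near (fun z : C => 2^-1 * (z^-1 - z)) eta.
Proof.
move=> eta0; apply: holomorphicMl.
exact: holomorphicD (holomorphic_inv eta0) (holomorphicN (@holomorphic_id R eta)).
Qed.

Lemma S_formula_holomorphic i j eta : eta != 0 -> \det (Hres Y eta) != 0 ->
  holomorphic_near (fun z => S_formula Y z i j) eta.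
Proof.
move=> eta0 D0; have hD := det_Hres_holomorphic eta0.
have h := holomorphicD (@holomorphic_cst R (- (i == j)%:R) eta)
  (holomorphicM (holomorphicM (half_diff_holomorphic eta0) (numerator_holomorphic i j eta0))
     (holomorphicV hD D0)).
apply: near_eq_holomorphic h.
by apply: filterS (continuous_neq0 (holomorphic_continuous hD) D0) => z; exact: S_formulaE.
Qed.

Lemma S_formula_meromorphic i j eta : eta != 0 ->
  meromorphic_at (fun z => S_formula Y z i j) eta.
Proof.
move=> eta0; have [k hk] := det_Hres_has_order eta0.
have h := meromorphicD (holomorphic_meromorphic (@holomorphic_cst R (- (i == j)%:R) eta))
  (meromorphicM (holomorphic_meromorphic
     (holomorphicM (half_diff_holomorphic eta0) (numerator_holomorphic i j eta0)))
     (has_order_meromorphicV hk)).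
apply: near_eq_meromorphic h.
by apply: filterS (det_Hres_near_neq0 eta0) => z; exact: S_formulaE.
Qed.

Lemma detS_formula_has_order eta k l : eta != 0 ->
  has_order (fun z => \det (Hres Y z)) eta k ->
  has_order (fun z => \det (Hres Y z)) eta^-1 l ->
  has_order (detS_formula Y) eta (l - k).
Proof.
move=> eta0 hk hl; have hq := has_order_div (has_order_comp_inv eta0 hl) hk.
have s0 : (-1 : C) ^+ r != 0 by rewrite expf_neq0 // oppr_eq0 oner_eq0.
exact: has_orderMl (@holomorphic_cst R ((-1) ^+ r) eta) s0 hq.
Qed.

(** Inverting twice reduces this to [has_order_meromorphicV], which treats both signs of the
    order. *)
Lemma has_order_meromorphic (f : C -> C) eta k : has_order f eta k -> meromorphic_at f eta.
Proof.
move=> hf; have c1 : has_order (fun=> 1 : C) eta 0.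
  exists (fun=> 1); split; [exact: holomorphic_cst|exact: oner_neq0|].
  by apply: (@filterE _ (eta^')) => z; rewrite expr0z mul1r.
have := has_order_meromorphicV (has_order_div c1 hf).
by apply: near_eq_meromorphic; apply: (@filterE _ (eta^')) => z; rewrite mul1r invrK.
Qed.

Lemma detS_formula_holomorphic eta : eta != 0 -> \det (Hres Y eta) != 0 ->
  holomorphic_near (detS_formula Y) eta.
Proof.
move=> eta0 D0; apply: holomorphicMl.
have eV0 : eta^-1 != 0 by rewrite invr_eq0.
exact: holomorphicM (holomorphic_comp_inv eta0 (det_Hres_holomorphic eV0))
  (holomorphicV (det_Hres_holomorphic eta0) D0).
Qed.

End ResonanceDeterminant.

(** * Recovering the constant terms from the resonance matrix and the attachment operator *)

Section Rigidity.
Context {R : realType} {F : finFieldType} {K : laurentField F}.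
Context {d r : nat}.
Local Notation C := (Cplx R).

Section OneQuotient.
Context {G : set (pgl K)} (hG : tree_lattice G) (Y : cusped_quotient R G d r).

(** Collapsing each ray to its attachment vertex extends a property of core vertices to the whole
    quotient, and from there to the tree. *)
Definition core_root (i : qvertex d r) : 'I_d :=
  match i with inl v => v | inr (c, _) => cq_att Y c end.

(** Translation by gam^-1 moves the edge to one that issues from the chosen lift of i. *)
Lemma nbr_count_adj x y i j : adj x y -> lies_over G (cq_lift Y) x i ->
  lies_over G (cq_lift Y) y j -> (0 < nbr_count Y i j)%N.
Proof.
move=> xy [gam Gg xE] yj; have [tx ty _] := xy.
have Pg := tree_lattice_PGL2 hG Gg; have GV := tree_lattice_pinv hG Gg.
apply: (@nbr_count_gt0 _ _ _ _ _ _ Y i j (pact (Defs.pinv gam) y)).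
  have := pact_adj (PGL2_pinv Pg) xy.
  by rewrite xE pactK //; exact: cq_lift_tree.
apply: (same_orbit_trans hG (cq_lift_tree Y j) yj).
by exists (Defs.pinv gam).
Qed.

(* The tree is connected, and the rays are attached to the core at one vertex
   each, so the core is connected. *)
Lemma core_root_invariant (P : 'I_d -> Prop) :
  (forall v w, nbr_count Y (inl v) (inl w) != 0%N -> P v -> P w) ->
  forall v w, P v -> P w.
Proof.
move=> hP v w Pv.
pose Q x := forall i, lies_over G (cq_lift Y) x i -> P (core_root i).
have root_adj i j : (0 < nbr_count Y i j)%N -> P (core_root i) -> P (core_root j).
  rewrite lt0n; case: i j => [v1|[c n]] [v2|[c' n']].
  - exact: hP.
  - by move=> /(nbr_count_core_ray hG)[_ <-].
  - by rewrite (nbr_count_ray hG) addn0; case: n => [|n] /=; rewrite ?muln0 //;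
      case: (inl _ =P inl v2) => [[<-]|_]; rewrite ?muln0.
  - rewrite (nbr_count_ray hG) /=.
    case: (inr (c, n.+1) =P inr (c', n')) => [[<- _]//|_]; rewrite addn0.
    case: n => [|n] /=; first by rewrite muln0.
    by case: (inr (c, n) =P inr (c', n')) => [[<- _]//|_]; rewrite muln0.
have Q_adj x y : adj x y -> Q x -> Q y.
  move=> xy Qx j yj; have [tx _ _] := xy.
  have [i xi] := cq_cover Y tx.
  exact: root_adj (nbr_count_adj xy xi yj) (Qx i xi).
have Qv : Q (cq_lift Y (inl v)).
  by move=> i /(lies_over_inj hG (lies_over_lift hG Y (inl v))) <-.
exact: (tree_connected Q_adj (cq_lift_tree Y _) (cq_lift_tree Y (inl w)) Qv)
  (lies_over_lift hG Y _).
Qed.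

End OneQuotient.

Context {G G' : set (pgl K)} (hG : tree_lattice G) (hG' : tree_lattice G').
Context (Y : cusped_quotient R G d r) (Y' : cusped_quotient R G' d r).
Context (eqH : forall mu, mu != 0 -> Hres Y' mu = Hres Y mu).
Context (eqA : attach Y' = attach Y).

Let a0 : sqrt_q R F != 0. Proof. exact: sqrt_q_neq0. Qed.

(* H_res(1) + H_res(-1) = A_L / a, the other terms being odd in mu. *)
Lemma core_adj_determined : core_adj Y' = core_adj Y.
Proof.
have two_a0 : (2 * sqrt_q R F)^-1 != 0 by rewrite invr_eq0 mulf_neq0 ?pnatr_eq0.
have sumE (G0 : set (pgl K)) (Y0 : cusped_quotient R G0 d r) v w :
    Hres Y0 1 v w + Hres Y0 (-1) v w = 2 * ((2 * sqrt_q R F)^-1 * core_adj Y0 v w).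
  rewrite !HresE; move: (core_adj Y0 v w) (rc _) => e m.
  by rewrite invrN !invr1; case: (v == w); rewrite ?mulr0n ?mulr1n; ring.
apply/matrixP => v w; apply: (mulfI two_a0).
have two0 : 2 != 0 :> C by rewrite pnatr_eq0.
apply: (mulfI two0); rewrite -!sumE !eqH // ?oppr_eq0 oner_neq0 //.
Qed.

(** The only nonzero entry in column c of the attachment operator sits in row v(c). *)
Lemma cq_att_determined c : cq_att Y' c = cq_att Y c.
Proof.
have /matrixP/(_ (cq_att Y c) c) := eqA; rewrite !mxE eqxx mulr1.
have := sqrt_mult_neq0 hG Y c; rewrite /sqrt_mult.
case: (cq_att Y c =P cq_att Y' c) => [->//|_] m0.
by rewrite mulr0 => m0'; rewrite -m0' eqxx in m0.
Qed.

Lemma cusp_mult_determined c : cusp_mult Y' c = cusp_mult Y c.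
Proof.
have /matrixP/(_ (cq_att Y c) c) := eqA.
rewrite !mxE cq_att_determined eqxx !mulr1 => /complexI /eqP.
rewrite eqr_sqrt ?ltW ?cusp_mult_gt0 // => /eqP //.
Qed.

Lemma lam_proportional : exists2 kappa : R, 0 < kappa &
  forall v, lam Y' (inl v) = kappa * lam Y (inl v).
Proof.
(* With an empty core the claim is vacuous; otherwise a base vertex v0 fixes kappa. *)
case: (pickP (fun _ : 'I_d => true)) => [v0 _|no]; last first.
  by exists 1 => // v; have := no v.
have l0 v : lam Y (inl v) != 0 by rewrite gt_eqF //; exact: lam_gt0.
exists (lam Y' (inl v0) / lam Y (inl v0)); first by rewrite divr_gt0 ?lam_gt0.
move=> w; pose P v := lam Y' (inl v) = lam Y' (inl v0) / lam Y (inl v0) * lam Y (inl v).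
apply: (core_root_invariant hG (Y := Y) (P := P) _ (v := v0)); last by rewrite /P divfK.
move=> v {}w vw; rewrite /P => Pv.
have nE u u' : nbr_count Y' (inl u) (inl u') = nbr_count Y (inl u) (inl u').
  by apply/eqP; rewrite -(eqr_nat C) -(core_adjE hG) -(core_adjE hG') core_adj_determined.
have wv : (nbr_count Y (inl w) (inl v))%:R != 0 :> R.
  by rewrite pnatr_eq0; apply: contraNneq vw => /(nbr_count_eq0 hG) ->.
apply: (mulfI wv); rewrite mulrCA -(nbr_count_lam hG Y (inl v) (inl w)).
by rewrite -nE -(nbr_count_lam hG' Y' (inl v) (inl w)) Pv nE mulrCA.
Qed.

Lemma Saut_formula_determined mu : mu != 0 -> Saut_formula Y' mu = Saut_formula Y mu.
Proof.
move=> mu0; have [kappa k0 lamE] := lam_proportional.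
have rk0 : (rc (Num.sqrt kappa) : C) != 0 by apply: rc_neq0; rewrite gt_eqF // sqrtr_gt0.
have q1 : (#|F|%:R + 1 : R) != 0 by rewrite gt_eqF // addr_gt0 ?ltr01 ?ltr0n ?(ltnW (card_residue_gt1 F)).
have wE c : cq_w Y' c = kappa * cq_w Y c.
  apply: (mulIf q1); rewrite -mulrA -!cusp_mult_lam_w //.
  by rewrite cusp_mult_determined cq_att_determined lamE mulrCA.
have UE : core_U Y' = rc (Num.sqrt kappa) *: core_U Y.
  apply/matrixP => v w; rewrite !mxE mulrnAr; congr (_ *+ _).
  by rewrite /sqrt_lam lamE sqrtrM ?rcM // ltW.
have WE : sqrt_W Y' = rc (Num.sqrt kappa) *: sqrt_W Y.
  apply/matrixP => c c'; rewrite !mxE mulrnAr; congr (_ *+ _).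
  by rewrite wE sqrtrM ?rcM // ltW.
have Wu : sqrt_W Y \in unitmx.
  apply: (invmx_diag _).1 => c; rewrite mxE; apply: rc_neq0.
  by rewrite gt_eqF // sqrtr_gt0 cq_w_gt0.
have HE : Hres_sym Y' mu = Hres_sym Y mu.
  rewrite /Hres_sym UE eqH // (invmxZl rk0 (core_U_unit hG Y)).
  by rewrite -!scalemxAl -scalemxAr scalerA mulfV // scale1r.
rewrite /Saut_formula /S_formula HE eqA WE (invmxZl rk0 Wu).
by rewrite -!scalemxAl -scalemxAr scalerA mulVf // scale1r.
Qed.

(** At regular s both sides are given by the formula. At a threshold or a zero of det H_res neither
    group has a constant-term matrix, and both sides are the default 0. *)
Lemma Saut_determined s : Saut Y' s = Saut Y s.
Proof.
have m0 := @mu_of_neq0 R F s.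
case: (boolP ((mu_of F s != 1) && (mu_of F s != -1))) => [/andP[m1 mN1]|mpm].
  have [D0|D0] := eqVneq (\det (Hres Y (mu_of F s))) 0.
    have n1 M : ~ constant_term_at Y s M.
      by move=> /(constant_term_at_regular hG); rewrite D0 eqxx.
    have n2 M : ~ constant_term_at Y' s M.
      by move=> /(constant_term_at_regular hG'); rewrite eqH // D0 eqxx.
    by rewrite (Saut_exceptional n1) (Saut_exceptional n2).
  have D0' : \det (Hres Y' (mu_of F s)) != 0 by rewrite eqH.
  rewrite (SautE hG m1 mN1 D0) (SautE hG' m1 mN1 D0').
  exact: Saut_formula_determined.
have n1 M : ~ constant_term_at Y s M by case; rewrite cpow_neq_1B (negPf mpm).
have n2 M : ~ constant_term_at Y' s M by case; rewrite cpow_neq_1B (negPf mpm).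
by rewrite (Saut_exceptional n1) (Saut_exceptional n2).
Qed.

End Rigidity.

(** * Identities near exceptional parameters, and limits *)

Section MeromorphicContinuation.
Context {R : realType} {F : finFieldType} {K : laurentField F}.
Context {G : set (pgl K)} (hG : tree_lattice G) {d r : nat} (Y : cusped_quotient R G d r).
Local Notation C := (Cplx R).
Implicit Types (mu eta z s : C).

(** The parameters where the eigenfunction definitions and the formulas can be compared directly; by
    [near_regular] the exceptions in the punctured plane are isolated. *)
Definition regular z := [/\ z != 0, z != 1, z != -1 & \det (Hres Y z) != 0].

Lemma near_regular eta : eta != 0 -> \forall z \near eta^', regular z.
Proof.
move=> eta0; have := det_Hres_near_neq0 Y eta0.
have : \forall z \near eta^', z != 0 /\ z != 1.
  by apply: filterS2 (dnbhs_neq eta 0) (dnbhs_neq eta 1).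
by apply: filterS3 (dnbhs_neq eta (-1)) => z zN1 [].
Qed.

Lemma cvg_mu_of s : mu_of F z @[z --> s] --> mu_of F s.
Proof.
exact: (@cvg_cpow R _ (nbhs s) (nbhs_filter s) #|F| (fun z => z - 2^-1) (s - 2^-1)
  (holomorphic_continuous (holomorphic_subr 2^-1 s))).
Qed.

Lemma cvg_dnbhs_mu_of s : mu_of F z @[z --> s^'] --> (mu_of F s)^'.
Proof.
apply: (cvg_dnbhs (f := fun z : C => mu_of F z)); first exact: cvg_mu_of.
have := cpow_locally_injective s (card_residue_gt1 (F := F)); apply: filterS => z.
by rewrite /mu_of !cpowB (inj_eq (mulIf _)) // invr_eq0 cpow_neq0.
Qed.

Lemma near_regular_mu_of s : \forall z \near s^', regular (mu_of F z).
Proof.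
have h := near_regular (@mu_of_neq0 R F s).
by have := @cvg_dnbhs_mu_of s regular h; rewrite nbhs_filterE.
Qed.

Lemma Sjac_regular z : regular z -> Sjac Y z = S_formula Y z.
Proof. by case=> z0 z1 zN1 Dz; exact: SjacE. Qed.

Lemma det_Sjac_regular z : regular z -> \det (Sjac Y z) = detS_formula Y z.
Proof.
move=> hz; rewrite Sjac_regular //; case: hz => z0 _ _ Dz.
exact: det_S_formula.
Qed.

Lemma Saut_regular s : regular (mu_of F s) -> Saut Y s = Saut_formula Y (mu_of F s).
Proof. by case=> _ m1 mN1 Dm; exact: SautE. Qed.

Lemma Saut_formulaE mu i j : Saut_formula Y mu i j =
  (cusp_weight Y i)^-1 * S_formula Y mu i j * cusp_weight Y j.
Proof.
have W0 c : (\row_c cusp_weight Y c : 'rV[C]_r) 0 c != 0.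
  by rewrite mxE cusp_weight_neq0.
rewrite (Saut_formula_weight hG) /weight_mx (invmx_diag W0).2.
by rewrite mul_mx_diag mxE mul_diag_mx !mxE.
Qed.

Lemma Saut_formula_holomorphic i j eta : eta != 0 -> \det (Hres Y eta) != 0 ->
  holomorphic_near (fun z => Saut_formula Y z i j) eta.
Proof.
move=> eta0 D0.
apply: (eq_holomorphic (fun z => Saut_formulaE z i j)).
exact: holomorphicM (holomorphicMl _ (S_formula_holomorphic hG i j eta0 D0))
  (@holomorphic_cst R _ eta).
Qed.

Lemma Saut_formula_meromorphic i j eta : eta != 0 ->
  meromorphic_at (fun z => Saut_formula Y z i j) eta.
Proof.
move=> eta0; have hc (k : C) := holomorphic_meromorphic (@holomorphic_cst R k eta).
have h := meromorphicM (meromorphicM (hc (cusp_weight Y i)^-1)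
  (S_formula_meromorphic hG Y i j eta0)) (hc (cusp_weight Y j)).
apply: near_eq_meromorphic h; apply: (@filterE _ (eta^')) => z.
exact: Saut_formulaE.
Qed.

(** The form of an equivalence covers the thresholds, where a limit need not exist. *)
Lemma near_eq_cvg_iff (f g : C -> C) eta (l : C) : (\forall z \near eta^', f z = g z) ->
  (f z @[z --> eta^'] --> l) <-> (g z @[z --> eta^'] --> l).
Proof.
by move=> fg; split; apply: cvg_trans; apply: near_eq_cvg; apply: filterS fg => z ->.
Qed.

Lemma Sjac_cvg i j mu : mu != 0 -> \det (Hres Y mu) != 0 ->
  Sjac Y z i j @[z --> mu^'] --> S_formula Y mu i j.
Proof.
move=> mu0 D0; apply/(near_eq_cvg_iff (g := fun z => S_formula Y z i j)).
  by apply: filterS (near_regular mu0) => z /Sjac_regular ->.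
exact: holomorphic_cvg_dnbhs (S_formula_holomorphic hG i j mu0 D0).
Qed.

Lemma det_Sjac_cvg mu : mu != 0 -> \det (Hres Y mu) != 0 ->
  \det (Sjac Y z) @[z --> mu^'] --> detS_formula Y mu.
Proof.
move=> mu0 D0; apply/(near_eq_cvg_iff (g := detS_formula Y)).
  by apply: filterS (near_regular mu0) => z /det_Sjac_regular.
exact: holomorphic_cvg_dnbhs (detS_formula_holomorphic mu0 D0).
Qed.

Lemma near_Saut s : \forall z \near s^', Saut Y z = Saut_formula Y (mu_of F z).
Proof. by apply: filterS (near_regular_mu_of s) => z; exact: Saut_regular. Qed.

Lemma Saut_cvg i j s : \det (Hres Y (mu_of F s)) != 0 ->
  Saut Y z i j @[z --> s^'] --> Saut_formula Y (mu_of F s) i j.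
Proof.
move=> D0; apply/(near_eq_cvg_iff (g := fun z => Saut_formula Y (mu_of F z) i j)).
  by apply: filterS (near_Saut s) => z ->.
have h := holomorphic_cvg_dnbhs (Saut_formula_holomorphic i j (mu_of_neq0 s) D0).
exact: (cvg_comp (fun z => mu_of F z) (fun z => Saut_formula Y z i j)
  (@cvg_dnbhs_mu_of s) h).
Qed.

Lemma det_Sjac_order eta k l : eta != 0 ->
  has_order (fun z => \det (Hres Y z)) eta k ->
  has_order (fun z => \det (Hres Y z)) eta^-1 l ->
  has_order (fun z => \det (Sjac Y z)) eta (l - k).
Proof.
move=> eta0 hk hl; apply: near_eq_has_order (detS_formula_has_order eta0 hk hl).
by apply: filterS (near_regular eta0) => z; exact: det_Sjac_regular.
Qed.

End MeromorphicContinuation.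
Theorem theorem4p1 (R : realType) (F : finFieldType) (K : laurentField F)
    (G : set (pgl K)) (hG : nonuniform_arithmetic_lattice G)
    (d r : nat) (hd : (0 < d)%N) (Y : cusped_quotient R G d r) :
  (* the exact identity of finite matrices *)
  (forall mu : Cplx R, mu != 0 -> Fmx Y mu = (2 * sqrt_q R F) *: Hres_sym Y mu) /\
  (* the Jacobi scattering matrix and its determinant *)
  (forall mu : Cplx R, mu != 0 -> \det (Hres Y mu) != 0 ->
    (mu != 1 -> mu != -1 ->
      [/\ jacobi_scattering_at Y mu (Sjac Y mu),
          Sjac Y mu = S_formula Y mu &
          \det (Sjac Y mu) = detS_formula Y mu]) /\
    (forall i j, Sjac Y z i j @[z --> mu^'] --> S_formula Y mu i j) /\
    \det (Sjac Y z) @[z --> mu^'] --> detS_formula Y mu) /\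
  (* the classical constant-term matrix *)
  (forall s : Cplx R, \det (Hres Y (mu_of F s)) != 0 ->
    (mu_of F s != 1 -> mu_of F s != -1 ->
      constant_term_at Y s (Saut Y s) /\
      Saut Y s = Saut_formula Y (mu_of F s)) /\
    (forall i j, Saut Y z i j @[z --> s^'] -->
       Saut_formula Y (mu_of F s) i j)) /\
  (* the resonance matrix and the attachment operator determine the constant
     terms *)
  (forall G' : set (pgl K), nonuniform_arithmetic_lattice G' ->
    forall Y' : cusped_quotient R G' d r,
    (forall mu, mu != 0 -> Hres Y' mu = Hres Y mu) -> attach Y' = attach Y ->
    forall s, Saut Y' s = Saut Y s) /\
  (* the determinant of the resonance matrix determines the scattering
     determinant *)
  (forall G' : set (pgl K), nonuniform_arithmetic_lattice G' ->
    forall (d' : nat) (Y' : cusped_quotient R G' d' r), (0 < d')%N ->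
    (forall mu, mu != 0 -> \det (Hres Y' mu) = \det (Hres Y mu)) ->
    forall mu, mu != 0 -> mu != 1 -> mu != -1 -> \det (Hres Y mu) != 0 ->
    \det (Sjac Y' mu) = \det (Sjac Y mu)) /\
  (* the scattering-determinant divisor *)
  (forall mu0 : Cplx R, mu0 != 0 ->
    [/\ has_order (fun mu => \det (Hres Y mu)) mu0 (m_res Y mu0),
        has_order (fun mu => \det (Sjac Y mu)) mu0
          (ord (fun mu => \det (Sjac Y mu)) mu0) &
        ord (fun mu => \det (Sjac Y mu)) mu0 =
          m_res Y mu0^-1 - m_res Y mu0]) /\
  (* meromorphic extension of all the identities *)
  [/\ mx_meromorphic_eq (Fmx Y) (fun mu => (2 * sqrt_q R F) *: Hres_sym Y mu),
      mx_meromorphic_eq (Sjac Y) (S_formula Y),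
      meromorphic_eq (fun mu => \det (Sjac Y mu)) (detS_formula Y),
      forall i j (eta : Cplx R), eta != 0 ->
        meromorphic_at (fun mu => Saut_formula Y mu i j) eta &
      forall eta : Cplx R, eta != 0 -> \forall mu \near eta^',
        forall s, mu_of F s = mu -> Saut Y s = Saut_formula Y mu] /\
  (* thresholds *)
  (forall eta : Cplx R, eta = 1 \/ eta = -1 ->
    [/\ forall i j (l : Cplx R), (Sjac Y z i j @[z --> eta^'] --> l) <->
                      (S_formula Y z i j @[z --> eta^'] --> l),
        forall (l : Cplx R), (\det (Sjac Y z) @[z --> eta^'] --> l) <->
                  (detS_formula Y z @[z --> eta^'] --> l) &
        forall s, mu_of F s = eta -> forall i j (l : Cplx R),
          (Saut Y z i j @[z --> s^'] --> l) <->
          (Saut_formula Y (mu_of F z) i j @[z --> s^'] --> l)]).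

Proof.
have [hL _ _] := hG.
split; first by move=> mu mu0; exact: Fmx_Hres.
split.
  move=> mu mu0 D0; split; last first.
    by split=> [i j|]; [exact: Sjac_cvg|exact: det_Sjac_cvg].
  move=> m1 mN1; have SE := SjacE hL mu0 m1 mN1 D0.
  by rewrite SE; split; [exact: jacobi_scattering_S_formula|reflexivity|
    exact: (det_S_formula hL mu0 D0)].
split.
  move=> s D0; split; last by move=> i j; exact: Saut_cvg.
  move=> m1 mN1; have SE := SautE hL m1 mN1 D0.
  by rewrite SE; split; [exact: constant_term_formula|reflexivity].
split.
  by move=> G' [hL' _ _] Y' eqH eqA s; exact: Saut_determined.
split.
  move=> G' [hL' _ _] d' Y' _ eqD mu mu0 m1 mN1 D0.
  have D0' : \det (Hres Y' mu) != 0 by rewrite eqD.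
  rewrite (SjacE hL mu0 m1 mN1 D0) (SjacE hL' mu0 m1 mN1 D0').
  apply: etrans (det_S_formula hL' mu0 D0') _; apply: etrans (esym (det_S_formula hL mu0 D0)).
  by rewrite /detS_formula !eqD ?invr_eq0.
split.
  move=> eta eta0; have etaV0 : eta^-1 != 0 by rewrite invr_eq0.
  (* Orders exist at both eta and eta^-1, so every [ord] below is a genuine order and not the
     default 0. *)
  have [k hk] := det_Hres_has_order Y eta0.
  have [l hl] := det_Hres_has_order Y etaV0.
  have hS := det_Sjac_order hL eta0 hk hl.
  by rewrite /m_res (has_order_ord hk) (has_order_ord hl) (has_order_ord hS).
split.
  split.
  - move=> i j eta eta0.
    have E : \forall z \near eta^', Fmx Y z i j = ((2 * sqrt_q R F) *: Hres_sym Y z) i j.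
      by move: (dnbhs_neq eta 0); apply: filterS => z z0; rewrite (Fmx_Hres hL Y z0).
    have h := holomorphic_meromorphic (Fmx_holomorphic hL Y i j eta0).
    by split=> //; apply: near_eq_meromorphic h; move: E; apply: filterS => z ->.
  - move=> i j eta eta0.
    have E : \forall z \near eta^', Sjac Y z i j = S_formula Y z i j.
      by move: (near_regular Y eta0); apply: filterS => z /(Sjac_regular hL) ->.
    have h := S_formula_meromorphic hL Y i j eta0.
    by split=> //; exact: near_eq_meromorphic h.
  - move=> eta eta0; have etaV0 : eta^-1 != 0 by rewrite invr_eq0.
    have [k hk] := det_Hres_has_order Y eta0.
    have [l hl] := det_Hres_has_order Y etaV0.
    split.
    + exact: has_order_meromorphic (det_Sjac_order hL eta0 hk hl).
    + exact: has_order_meromorphic (detS_formula_has_order eta0 hk hl).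
    + by move: (near_regular Y eta0); apply: filterS => z /(det_Sjac_regular hL).
  - by move=> i j eta; exact: Saut_formula_meromorphic.
  - move=> eta eta0; move: (near_regular Y eta0); apply: filterS => z hz s sz.
    by rewrite -sz in hz *; exact: Saut_regular.
move=> eta eta1.
have eta0 : eta != 0 by case: eta1 => ->; rewrite ?oppr_eq0 oner_neq0.
have nr := near_regular Y eta0; split.
- move=> i j l; apply: near_eq_cvg_iff.
  by move: nr; apply: filterS => z /(Sjac_regular hL) ->.
- move=> l; apply: near_eq_cvg_iff.
  by move: nr; apply: filterS => z /(det_Sjac_regular hL).
- move=> s _ i j l; apply: near_eq_cvg_iff.
  by move: (near_Saut hL Y s); apply: filterS => z ->.
Qed.
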